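(* Let $A$ be a Banach algebra, let $X$ be a left Banach $A$-module, and let $n\ge0$ be an integer. (i) Suppose that the topology on $\operatorname{Ext}^{n+1}_A(X,Y)$ is trivial for each left Banach $A$-module $Y$. Then $\operatorname{dh}_AX\le n$. (ii) Suppose that the topology on $\operatorname{Ext}^{n+1}_A(Y,X)$ is trivial for each left Banach $A$-module $Y$. Then $\operatorname{inj.dh}_AX\le n$. (iii) Suppose that the topology on $\operatorname{Ext}^{n+1}_A(X,Y^* )$ is trivial for each right Banach $A$-module $Y$. Then $\operatorname{w.dh}_AX\le n$.
   Context: Banach algebras are not assumed unital. A left (right) Banach $A$-module is a Banach space with a jointly continuous bilinear associative left (right) action of $A$; morphisms are bounded linear module maps; ${}_A\mathbf h(X,Y)$ is the Banach space (operator norm) of morphisms of left modules. If $Y$ is a right Banach $A$-module, $Y^*$ is a left Banach $A$-module via $(a\cdot f)(y)=f(y\cdot a)$. A chain complex of Banach modules is admissible if it splits as a complex of Banach spaces. An admissible epimorphism is a surjective morphism having a bounded linear right inverse. $P$ is projective if for each admissible epimorphism $X\to Y$ the induced map ${}_A\mathbf h(P,X)\to{}_A\mathbf h(P,Y)$ is onto. A projective resolution of $X$ is a chain complex $P_\bullet=(P_n,d_n)_{n\ge0}$ of projective modules with a morphism $P_0\to X$ such that $P_\bullet\to X\to0$ is admissible. $\operatorname{Ext}^n_A(X,Y)$ is the $n$th cohomology of ${}_A\mathbf h(P_\bullet,Y)$, seminormed by the quotient seminorm (cocycles modulo coboundaries); its topology does not depend on the choice of resolution. The topology is trivial if it is indiscrete,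 i.e. the coboundaries are dense in the cocycles. The projective homological dimension $\operatorname{dh}_AX$ (respectively, the injective homological dimension $\operatorname{inj.dh}_AX$) is the least integer $n$ such that $\operatorname{Ext}^{n+1}_A(X,Y)=0$ (respectively, $\operatorname{Ext}^{n+1}_A(Y,X)=0$) for each left Banach $A$-module $Y$. The weak homological dimension $\operatorname{w.dh}_AX$ is the least integer $n$ such that $\operatorname{Ext}^{n+1}_A(X,Y^* )=0$ for each right Banach $A$-module $Y$. (Here $n\ge 0$, and vanishing is as vector spaces.) *)

(* Defs.v *)
From HB Require Import structures.
From mathcomp Require Import all_boot all_order all_algebra.
From mathcomp Require Import complex.
From mathcomp Require Import all_classical all_reals.
From mathcomp Require Import ereal topology normedtype derive.

Set Implicit Arguments.
Unset Strict Implicit.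
Unset Printing Implicit Defensive.

Import Order.TTheory GRing.Theory Num.Theory.
Import numFieldNormedType.Exports.

Local Open Scope classical_set_scope.
Local Open Scope ring_scope.

(* Banach spaces are complex; norms in a completeNormedModType R[i] take their
   values among the nonnegative reals of R[i]. *)
Notation banachType R := (completeNormedModType R[i]).

Section BoundedLinear.
Variables (R : realType) (V W : normedModType R[i]).

Definition is_blin : {pred V -> W} := [pred f |
  `[< linear f /\ exists M : R[i], forall x, `|f x| <= M * `|x| >]].

Lemma is_blin_submod : submod_closed is_blin.
Proof.
split.
  apply/asboolP; split; first by move=> a x y /=; rewrite scaler0 addr0.
  by exists 0 => x; rewrite normr0 mul0r.
move=> a f g /asboolP[fl [M fM]] /asboolP[gl [N gN]]; apply/asboolP; split.
  move=> k x y /=; rewrite !fctE fl gl !scalerDr !scalerA (mulrC a k).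
  by rewrite addrACA.
exists (`|a| * M + N) => x; rewrite mulrDl.
apply: (le_trans (ler_normD _ _)); apply: lerD; last exact: gN.
by rewrite normrZ -mulrA ler_wpM2l.
Qed.

HB.instance Definition _ := GRing.isSubmodClosed.Build _ _ is_blin is_blin_submod.

Record blin := Blin { blin_fun :> V -> W; blinP : blin_fun \in is_blin }.

HB.instance Definition _ := [isSub of blin for blin_fun].
HB.instance Definition _ := [Choice of blin by <:].
HB.instance Definition _ := [SubChoice_isSubLmodule of blin by <:].
End BoundedLinear.

Section ComplexFacts.
Variable R : realType.
Implicit Types (r : R) (z : R[i]).

Lemma ge0_ReK z : 0 <= z -> (complex.Re z)%:C%C = z.
Proof. by case: z => a b; rewrite lecE /= => /andP[/eqP-> _]. Qed.

Lemma Re_le z1 z2 : z1 <= z2 -> complex.Re z1 <= complex.Re z2.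
Proof. by rewrite lecE => /andP[_]. Qed.

Lemma norm_ReIm_le z :
  `|z| <= `|complex.Re z|%:C%C + `|complex.Im z|%:C%C.
Proof.
case: z => a b /=.
have -> : (a +i* b)%C = a%:C%C + 'i%C * b%:C%C.
  by simpc.
apply: (le_trans (ler_normD _ _)); rewrite normrM.
have -> : `|'i%C : R[i]| = 1 by rewrite normc_def /= expr0n expr1n add0r sqrtr1.
rewrite mul1r; have normC r : `|r%:C%C| = `|r|%:C%C.
  by rewrite normc_def /= expr0n addr0 sqrtr_sqr.
by rewrite !normC.
Qed.

Lemma complex_complete (F : set_system R[i]^o) :
  ProperFilter F -> cauchy F -> cvg F.
Proof.
move=> FF /cauchy_ballP Fc.
have part (g : R[i] -> R) : (forall z, `|g z|%:C%C <= `|z|) ->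
    {morph g : x y / x - y} -> cvg (g @ F).
  move=> gle gB; apply/cauchy_cvgP/cauchy_ballP => e e0.
  have e0' : 0 < e%:C%C :> R[i] by rewrite ltcR.
  have [[Q1 Q2] /= [FQ1 FQ2] Q] := Fc _ e0'.
  exists (g @` Q1, g @` Q2) => /=.
    by split; [apply: filterS FQ1|apply: filterS FQ2] => x Qx; exists x.
  move=> [_ _] /= [[x Q1x <-] [y Q2y <-]].
  rewrite -ball_normE /= -gB -ltcR (le_lt_trans (gle _))//.
  by have := Q (x, y) (conj Q1x Q2y); rewrite /= -ball_normE.
have cRe : cvg (@complex.Re R @ F).
  by apply: part => [z|[a b] [c d]//]; rewrite normc_ge_Re.
have cIm : cvg (@complex.Im R @ F).
  apply: part => [[a b]|[a b] [c d]//]; rewrite normc_def /= lecR.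
  by rewrite -sqrtr_sqr; apply: ler_wsqrtr; rewrite lerDr sqr_ge0.
apply/cvg_ex; exists (lim (@complex.Re R @ F) +i* lim (@complex.Im R @ F))%C.
apply/cvgrPdist_le => e e0.
have eE := ge0_ReK (ltW e0).
have e2 : 0 < complex.Re e / 2 by rewrite divr_gt0// -ltcR eE.
move/cvgrPdist_le : cRe => /(_ _ e2) cRe.
move/cvgrPdist_le : cIm => /(_ _ e2) cIm.
near=> z; apply: (le_trans (norm_ReIm_le _)).
rewrite -eE (splitr (complex.Re e)) -rmorphD lecR; apply: lerD.
  have -> : complex.Re (lim (@complex.Re R @ F) +i* lim (@complex.Im R @ F) - z)%C
     = lim (@complex.Re R @ F) - complex.Re z by case: (z).
  by near: z.
have -> : complex.Im (lim (@complex.Re R @ F) +i* lim (@complex.Im R @ F) - z)%C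
     = lim (@complex.Im R @ F) - complex.Im z by case: (z).
by near: z.
Unshelve. all: by end_near. Qed.

End ComplexFacts.

(* The one-dimensional Banach space; an alias, because the structures of the
   regular module R[i]^o would clash with the completeness instance that the
   library declares on K^o for K : realType. *)
Definition Cspace (R : realType) : Type := R[i]^o.
HB.instance Definition _ (R : realType) :=
  NormedModule.copy (Cspace R) R[i]^o.
HB.instance Definition _ (R : realType) :=
  Uniform_isComplete.Build (Cspace R) (@complex_complete R).

Section OperatorNorm.
Variables (R : realType) (V W : normedModType R[i]).
Implicit Types f g : blin V W.

Lemma blin_linear f : linear f.
Proof. by have /asboolP[] := blinP f. Qed.

HB.instance Definition _ f :=
  GRing.isLinear.Build _ _ _ _ (blin_fun f) (blin_linear f).

Lemma blin_bounded f : exists M : R[i], forall x, `|f x| <= M * `|x|.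
Proof. by have /asboolP[] := blinP f. Qed.

(* The supremum is taken in R, where it exists, and cast back to R[i]. *)
Definition opnorm f : R[i] :=
  (sup [set complex.Re `|f x| | x in [set x : V | `|x| <= 1%R]])%:C%C.

Lemma opnorm_has_sup f :
  has_sup [set complex.Re `|f x| | x in [set x : V | `|x| <= 1%R]].
Proof.
split; first by exists (complex.Re `|f 0|), 0 => //=; rewrite normr0.
have [M fM] := blin_bounded f.
exists (complex.Re `|M|) => _ [x x1 <-]; apply: Re_le.
have := fM x; have : 0 <= `|f x| by [].
move=> _ /le_trans; apply.
have [->|x0] := eqVneq x 0; first by rewrite normr0 mulr0.
have M0 : 0 <= M.
  by rewrite -(@pmulr_lge0 _ `|x|) ?normr_gt0// (le_trans _ (fM x)).
by rewrite ger0_norm// ler_piMr.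
Qed.

Lemma opnorm_le f M : 0 <= M -> (forall x, `|f x| <= M * `|x|) -> opnorm f <= M.
Proof.
move=> M0 fM; rewrite -(ge0_ReK M0) lecR; apply: ge_sup.
  by have [] := opnorm_has_sup f.
move=> _ [x /= x1 <-]; apply: Re_le; apply: (le_trans (fM x)).
by rewrite ler_piMr.
Qed.

Lemma opnorm_ge0 f : 0 <= opnorm f.
Proof.
rewrite lecR; apply: (@le_trans _ _ (complex.Re `|f 0|)).
  by rewrite linear0 normr0.
apply: (sup_upper_bound (opnorm_has_sup f)); exists 0 => //=.
by rewrite normr0.
Qed.

Lemma le_opnorm f x : `|f x| <= opnorm f * `|x|.
Proof.
have [->|x0] := eqVneq x 0; first by rewrite linear0 !normr0 mulr0.
have nx0 : 0 < `|x| by rewrite normr_gt0.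
rewrite -ler_pdivrMr// mulrC -[X in X * _]ger0_norm ?invr_ge0// -normrZ -linearZ/=.
rewrite -(ge0_ReK (normr_ge0 _)) lecR.
apply: (sup_upper_bound (opnorm_has_sup f)); exists (`|x|^-1 *: x) => //=.
by rewrite normrZ ger0_norm ?invr_ge0// mulVf ?normr_eq0.
Qed.

Lemma blinDE f g x : (f + g) x = f x + g x. Proof. by []. Qed.
Lemma blinBE f g x : (f - g) x = f x - g x. Proof. by []. Qed.
Lemma blinZE (k : R[i]) f x : (k *: f) x = k *: f x. Proof. by []. Qed.
Lemma blin_ext f g : f =1 g -> f = g.
Proof. by move=> fg; apply/val_inj/funext. Qed.

Lemma opnormD f g : opnorm (f + g) <= opnorm f + opnorm g.
Proof.
apply: opnorm_le => [|x]; first by rewrite addr_ge0 ?opnorm_ge0.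
by rewrite blinDE mulrDl (le_trans (ler_normD _ _))// lerD ?le_opnorm.
Qed.

Lemma opnormZ_le (k : R[i]) f : opnorm (k *: f) <= `|k| * opnorm f.
Proof.
apply: opnorm_le => [|x]; first by rewrite mulr_ge0 ?opnorm_ge0.
by rewrite blinZE normrZ -mulrA ler_wpM2l ?le_opnorm.
Qed.

Lemma opnormZ (k : R[i]) f : opnorm (k *: f) = `|k| * opnorm f.
Proof.
apply/eqP; rewrite eq_le opnormZ_le /=.
have [->|k0] := eqVneq k 0; first by rewrite normr0 mul0r opnorm_ge0.
rewrite -ler_pdivlMl ?normr_gt0// -normfV.
by rewrite -{1}[f](scalerK k0) opnormZ_le.
Qed.

Lemma opnorm_eq0 f : opnorm f = 0 -> f = 0.
Proof.
move=> f0; apply: blin_ext => x; apply/normr0_eq0/eqP.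
by rewrite eq_le normr_ge0 andbT -(mul0r `|x|) -f0 le_opnorm.
Qed.

HB.instance Definition _ :=
  Lmodule_isNormed.Build R[i] (blin V W) opnormD opnormZ opnorm_eq0.

Lemma blin_normE f : `|f| = opnorm f. Proof. by []. Qed.

End OperatorNorm.

Section BlinComplete.
Variables (R : realType) (V : normedModType R[i]) (W : banachType R).

Lemma blin_complete (F : set_system (blin V W)) :
  ProperFilter F -> cauchy F -> cvg F.
Proof.
move=> FF /cauchy_ballP Fc.
have Fc2 (e : R[i]) : 0 < e -> exists Q : set (blin V W) * set (blin V W),
    [/\ F Q.1, F Q.2 & forall f h, Q.1 f -> Q.2 h -> `|f - h| <= e].
  move=> e0; have [[Q1 Q2] /= [FQ1 FQ2] Q] := Fc _ e0.
  exists (Q1, Q2); split => //= f h Qf Qh; apply/ltW.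
  by have := Q (f, h) (conj Qf Qh); rewrite /= -ball_normE.
have cv x : cvg ((fun f : blin V W => f x) @ F).
  apply/cauchy_cvgP/cauchy_ballP => e e0.
  have x0 : 0 < `|x| + 1 by rewrite ltr_wpDl.
  have [[Q1 Q2] /= [FQ1 FQ2 Q]] := Fc2 _ (divr_gt0 e0 x0).
  exists ((fun f : blin V W => f x) @` Q1, (fun f : blin V W => f x) @` Q2) => /=.
    by split; [apply: (@filterS _ F _ _ _ _ FQ1)|apply: (@filterS _ F _ _ _ _ FQ2)] => f Qf; exists f.
  move=> [_ _] /= [[f Qf <-] [h Qh <-]].
  rewrite -ball_normE /= -blinBE (le_lt_trans (le_opnorm _ _))//.
  rewrite (le_lt_trans (ler_wpM2r (normr_ge0 x) (Q _ _ Qf Qh)))//.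
  by rewrite mulrAC ltr_pdivrMr// ltr_pM2l// ltrDl.
pose g x := lim ((fun f : blin V W => f x) @ F).
have gP x : (fun f : blin V W => f x) @ F --> g x by exact: cv.
have key (e : R[i]) : 0 < e ->
    F [set f : blin V W | forall x, `|g x - f x| <= e * `|x|].
  move=> e0; have [[Q1 Q2] /= [FQ1 FQ2 Q]] := Fc2 _ e0.
  apply: (@filterS _ F _ _ _ _ FQ1) => f Qf x; apply/ler_addgt0Pr => d d0.
  have /cvgrPdist_le/(_ _ d0) gx := gP x.
  have [h [Qh /= hx]] := filter_ex (filterI FQ2 gx).
  rewrite (le_trans (ler_distD (h x) _ _))// addrC lerD// distrC -blinBE.
  by rewrite (le_trans (le_opnorm _ _))// ler_wpM2r// -blin_normE Q.
have glin : linear g.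
  move=> k x y; apply: (cvg_lim (@norm_hausdorff _ _)).
  rewrite (_ : (fun f : blin V W => f (k *: x + y)) =
               (fun f : blin V W => k *: f x + f y)); last first.
    by apply/funext => f; rewrite linearP.
  by apply: cvgD; [apply: cvgZr|].
have gbnd : g \in @is_blin R V W.
  apply/asboolP; split => //.
  have [f fg] := filter_ex (key 1 ltr01).
  exists (1 + opnorm f) => x.
  rewrite -[g x](subrK (f x)) mulrDl (le_trans (ler_normD _ _))//.
  by rewrite lerD// le_opnorm.
apply/cvg_ex; exists (Blin gbnd); apply/cvgrPdist_le => e e0.
apply: (@filterS _ F _ _ _ _ (key _ e0)) => f fe /=.
rewrite blin_normE; apply: opnorm_le => [|x]; first exact: ltW.
by rewrite blinBE /=; exact: fe.
Qed.

HB.instance Definition _ := Uniform_isComplete.Build (blin V W) blin_complete.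

End BlinComplete.

Section BilinearContinuous.
Variables (K : numFieldType) (U V W : normedModType K).

Lemma bounded_bilinear_continuous (f : {bilinear U -> V -> W}) (k : K) :
  0 <= k -> (forall u v, `|f u v| <= k * `|u| * `|v|) ->
  continuous (fun p : U * V => f p.1 p.2).
Proof.
move=> k0 fk -[u v]; apply/cvgrPdist_le => e e0 /=.
pose M := k * (`|u| + `|v| + 1) + 1.
have M0 : 0 < M by rewrite ltr_wpDl// mulr_ge0// addr_ge0// addr_ge0.
pose d := e / (M * 2).
have d0 : 0 < d by rewrite divr_gt0// mulr_gt0.
have kd w : w <= `|u| + `|v| + 1 -> 0 <= w -> k * w * d <= e / 2.
  move=> wle w0; rewrite -[leRHS]mulr1 /d invfM.
  rewrite (_ : k * w * (e * (M^-1 / 2)) = e / 2 * (k * w / M)); last first.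
    by rewrite mulrCA -[RHS]mulrA; congr (_ * _); rewrite mulrA mulrC.
  rewrite ler_wpM2l ?divr_ge0 ?ltW// ltr_pdivrMr// mul1r.
  by rewrite ltr_pwDr// ler_wpM2l.
have c1 : (fun p : U * V => p.1) @ (u, v) --> u by exact: cvg_fst.
have c2 : (fun p : U * V => p.2) @ (u, v) --> v by exact: cvg_snd.
move/cvgrPdist_le : (c1) => /(_ _ d0) n1.
move/cvgrPdist_le : (c1) => /(_ _ ltr01) n1'.
move/cvgrPdist_le : (c2) => /(_ _ d0) n2.
near=> p.
have -> : f u v - f p.1 p.2 = f (u - p.1) v + f p.1 (v - p.2).
  by rewrite linearBl linearBr/= addrA subrK.
rewrite (le_trans (ler_normD _ _))// (splitr e) lerD//.
  rewrite (le_trans (fk _ _))//.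
  have vle : `|v| <= `|u| + `|v| + 1 by rewrite ler_wpDr// ler_wpDl.
  apply: le_trans (kd _ vle (normr_ge0 _)).
  by rewrite mulrAC ler_wpM2l ?mulr_ge0//; near: p.
rewrite (le_trans (fk _ _))//.
have ple : `|p.1| <= `|u| + `|v| + 1.
  rewrite (@le_trans _ _ (`|u| + 1))//; last by rewrite lerD2r lerDl.
  rewrite -[p.1](subrK u) addrC (le_trans (ler_normD _ _))//.
  by rewrite lerD2l distrC; near: p.
apply: le_trans (kd _ ple (normr_ge0 _)).
by rewrite ler_wpM2l ?mulr_ge0//; near: p.
Unshelve. all: by end_near. Qed.

End BilinearContinuous.


Record banachAlgebra (R : realType) := BanachAlgebra {
  ba_space :> banachType R;
  ba_mul : {bilinear ba_space -> ba_space -> ba_space};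
  ba_mulA : forall a b c, ba_mul a (ba_mul b c) = ba_mul (ba_mul a b) c;
  ba_normM : forall a b, `|ba_mul a b| <= `|a| * `|b| }.

Record leftModule (R : realType) (A : banachAlgebra R) := LeftModule {
  lm_space :> banachType R;
  lm_act : {bilinear A -> lm_space -> lm_space};
  lm_actA : forall a b x, lm_act (ba_mul A a b) x = lm_act a (lm_act b x);
  lm_cont : continuous (fun p : A * lm_space => lm_act p.1 p.2) }.

Record rightModule (R : realType) (A : banachAlgebra R) := RightModule {
  rm_space :> banachType R;
  rm_act : {bilinear rm_space -> A -> rm_space};
  rm_actA : forall x a b, rm_act x (ba_mul A a b) = rm_act (rm_act x a) b;
  rm_cont : continuous (fun p : rm_space * A => rm_act p.1 p.2) }.

Section Dual.
Variables (R : realType) (A : banachAlgebra R) (Y : rightModule A).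
Local Notation dualspace := (blin Y (Cspace R)).

Lemma dual_act_subproof (a : A) (f : dualspace) :
  (fun y : Y => f (rm_act Y y a)) \in @is_blin R Y (Cspace R).
Proof.
apply/asboolP; split=> [k x y|]; first by rewrite linearPl linearP.
have [c _ cP] := bilinear_schwarz (@rm_cont _ _ Y).
exists (opnorm f * (c * `|a|)) => y; rewrite (le_trans (le_opnorm _ _))//.
by rewrite -mulrA ler_wpM2l ?opnorm_ge0// -mulrA [`|a| * _]mulrC mulrA cP.
Qed.

Definition dual_act (a : A) (f : dualspace) : dualspace :=
  Blin (dual_act_subproof a f).

Lemma dual_act_bilinear : bilinear_for *:%R *:%R dual_act.
Proof.
split=> [f k a b|a k f g]; apply: blin_ext => y //=.
by rewrite linearPr linearP.
Qed.

HB.instance Definition _ := bilinear_isBilinear.Build R[i] A dualspace dualspace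
  *:%R *:%R dual_act dual_act_bilinear.

Lemma dual_actA a b f : dual_act (ba_mul A a b) f = dual_act a (dual_act b f).
Proof. by apply: blin_ext => y /=; rewrite rm_actA. Qed.

Lemma dual_cont : continuous (fun p : A * dualspace => dual_act p.1 p.2).
Proof.
have [c c0 cP] := bilinear_schwarz (@rm_cont _ _ Y).
apply: (@bounded_bilinear_continuous _ _ _ _ _ c); first exact: ltW.
move=> a f; rewrite [leLHS]blin_normE; apply: opnorm_le => [|y /=].
  by rewrite !mulr_ge0// ltW.
rewrite (le_trans (le_opnorm _ _))// -blin_normE.
rewrite (_ : c * `|a| * `|f| * `|y| = `|f| * (c * `|y| * `|a|)).
  by rewrite ler_wpM2l.
by rewrite mulrAC [RHS]mulrC; congr (_ * _); rewrite mulrAC.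
Qed.

Definition dual : leftModule A := LeftModule dual_actA dual_cont.

End Dual.

Section Homology.
Variables (R : realType) (A : banachAlgebra R).
Implicit Types X Y : leftModule A.

(* The space of module morphisms, a subspace of the Banach space of bounded
   operators; its norm is the operator norm. *)
Definition hom X Y : set (blin X Y) :=
  [set f | forall a x, f (lm_act X a x) = lm_act Y a (f x)].

Definition admissible_epi X Y (p : blin X Y) : Prop :=
  [/\ hom p, range p = setT &
      exists s : blin Y X, forall y, p (s y) = y].

Definition projective (P : leftModule A) : Prop :=
  forall X Y (p : blin X Y), admissible_epi p ->
  forall f : blin P Y, hom f ->
  exists2 g : blin P X, hom g & forall x, p (g x) = f x.

(* Complexes ... -> C 1 -> C 0 -> 0. *)
Record chainComplex := ChainComplex {
  cc_obj :> nat -> leftModule A;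
  cc_diff : forall n, blin (cc_obj n.+1) (cc_obj n);
  cc_hom : forall n, hom (cc_diff n);
  cc_diff2 : forall n x, cc_diff n (cc_diff n.+1 x) = 0 }.

(* C splits as a complex of Banach spaces, i.e., has a contracting homotopy s
   consisting of bounded operators. *)
Definition admissible (C : chainComplex) : Prop :=
  exists s : forall n, blin (C n) (C n.+1),
    (forall x, cc_diff C 0 (s 0%N x) = x) /\
    (forall n x, cc_diff C n.+1 (s n.+1 x) + s n (cc_diff C n x) = x).

Section Augmented.
Variables (P : chainComplex) (X : leftModule A) (eps : blin (P 0) X).
Hypotheses (epsH : hom eps) (epsd : forall x, eps (cc_diff P 0 x) = 0).

Definition aug_obj n : leftModule A := if n is m.+1 then P m else X.

Definition aug_diff n : blin (aug_obj n.+1) (aug_obj n) :=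
  if n is m.+1 return blin (aug_obj n.+1) (aug_obj n) then cc_diff P m else eps.

Lemma aug_hom n : hom (aug_diff n).
Proof. by case: n => // n; exact: cc_hom. Qed.

Lemma aug_diff2 n x : aug_diff n (aug_diff n.+1 x) = 0.
Proof. by case: n x => // n; exact: cc_diff2. Qed.

(* The complex ... -> P 1 -> P 0 -> X -> 0, with X in degree 0. *)
Definition augmented : chainComplex := ChainComplex aug_hom aug_diff2.

End Augmented.

Record projResolution X := ProjResolution {
  pr_cplx :> chainComplex;
  pr_proj : forall n, projective (pr_cplx n);
  pr_eps : blin (pr_cplx 0) X;
  pr_epsH : hom pr_eps;
  pr_epsd : forall x, pr_eps (cc_diff pr_cplx 0 x) = 0;
  pr_adm : admissible (augmented pr_epsH pr_epsd) }.

(* Ext^n(X, Y) is the quotient of cocycles by coboundaries, for P a projective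
   resolution of X. *)
Definition cocycles (P : chainComplex) Y n : set (blin (P n) Y) :=
  [set f | hom f /\ forall x, f (cc_diff P n x) = 0].

Definition coboundaries (P : chainComplex) Y n : set (blin (P n) Y) :=
  if n is m.+1 return set (blin (P n) Y) then
    [set f | exists2 g : blin (P m) Y, hom g &
             forall x, f x = g (cc_diff P m x)]
  else [set 0].

(* Neither of the two properties below depends on the resolution, and every
   module has one.  Triviality of the topology is asked for some resolution and
   vanishing for every resolution, so that an implication from the first to the
   second is in its strongest form. *)
Definition Ext_topology_trivial n X Y : Prop :=
  exists P : projResolution X, @cocycles P Y n `<=` closure (@coboundaries P Y n).

Definition Ext_eq0 n X Y : Prop :=
  forall P : projResolution X, @cocycles P Y n `<=` @coboundaries P Y n.

(* The least natural number satisfying Q; +oo if there is none. *)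
Definition least (Q : nat -> Prop) : \bar R :=
  ereal_inf [set (n%:R)%:E | n in [set n | Q n]].

Definition dh X := least (fun n => forall Y, Ext_eq0 n.+1 X Y).

Definition inj_dh X := least (fun n => forall Y, Ext_eq0 n.+1 Y X).

Definition w_dh X :=
  least (fun n => forall Y : rightModule A, Ext_eq0 n.+1 X (dual Y)).

End Homology.

(* Main.v *)
From HB Require Import structures.
From mathcomp Require Import all_boot all_order all_algebra.
From mathcomp Require Import complex.
From mathcomp Require Import all_classical all_reals.
From mathcomp Require Import ereal topology normedtype derive.
Require Import Defs.

Import Order.TTheory GRing.Theory Num.Theory.
Import numFieldNormedType.Exports.
Local Open Scope classical_set_scope.
Local Open Scope ring_scope.

Set Implicit Arguments.
Unset Strict Implicit.
Unset Printing Implicit Defensive.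

(** Write h(P, Y) for the morphisms from P to Y. For a resolution P of X, the
    (n+1)-coboundaries with values in Y are the image of the operator T from
    h(P_n, Y) to the space Z of (n+1)-cocycles given by composition with the
    differential. Triviality of the topology says that T has dense range; the
    theorem says that T is onto, provided that the range is dense for enough
    modules. The extra strength comes from applying the hypothesis to one module
    that encodes all bounded sequences.

    - If every bounded sequence (z_k) in Z admits a bounded sequence (g_k) in
      h(P_n, Y) with |z_k - T g_k| <= 1/2 for all k, then T is onto
      ([almost_onto]). Indeed half-approximants of the unit ball of Z then have a
      common bound, since otherwise elements requiring larger and larger
      approximants would form a bad sequence; and iterating on the error, as in
      the open mapping theorem, writes each cocycle as T of a geometrically
      convergent series.

    - A bounded sequence of cocycles with values in Y is a single cocycle with
      values in l^oo(Y), and an approximation of it by a coboundary is a bounded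
      sequence of approximations. Density for l^oo(Y) therefore gives the above
      condition for Y, and (i) follows ([linf_sequence], [vanishing_of_target]).
      For (iii) the role of l^oo(Y^* ) is played by the dual of l^1(Y)
      ([dual_sequence]).

    - For (ii), a bounded sequence of cocycles on P is a single cocycle on the
      complex l^1(P) ([vanishing_of_source]), and l^1(P) is a projective
      resolution of l^1(Y) when P is one of Y ([l1_resolution]). The point is
      that l^1 of a projective module P is projective ([projective_l1]): a
      morphism from l^1(P) to F is a morphism from P to l^oo(F).

    The hypothesis provides a trivial topology for one resolution, while the
    argument requires it for prescribed ones. The comparison theorem bridges this
    ([closure_coboundaries_transfer]): chain maps between two resolutions exist
    and are unique up to homotopy, because a morphism from a projective module
    into the range of a morphism d lifts through d as soon as d splits as a
    bounded operator ([projective_lift]). *)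

(** * Bounded operators *)

Section Operators.
Variable R : realType.
Implicit Types U V W : normedModType R[i].

Lemma bounded_is_blin V W (f : V -> W) (M : R[i]) :
  linear f -> (forall x, `|f x| <= M * `|x|) -> f \in @is_blin R V W.
Proof. by move=> fl fM; apply/asboolP; split=> //; exists M. Qed.

Definition bounded_blin V W (f : V -> W) (fl : linear f) (M : R[i])
    (fM : forall x, `|f x| <= M * `|x|) : blin V W :=
  Blin (bounded_is_blin fl fM).

Lemma blin_id_le V (x : V) : `|idfun x| <= 1 * `|x|.
Proof. by rewrite mul1r. Qed.

Definition blin_id V : blin V V :=
  bounded_blin (fun _ _ _ => erefl) (@blin_id_le V).

Lemma blin_comp_linear U V W (f : blin V W) (g : blin U V) :
  linear (fun x => f (g x)).
Proof. by move=> k x y; rewrite !linearP. Qed.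

Lemma blin_comp_le U V W (f : blin V W) (g : blin U V) x :
  `|f (g x)| <= opnorm f * opnorm g * `|x|.
Proof.
apply: (le_trans (le_opnorm _ _)).
by rewrite -mulrA ler_wpM2l ?opnorm_ge0 ?le_opnorm.
Qed.

Definition blin_comp U V W (f : blin V W) (g : blin U V) : blin U W :=
  bounded_blin (blin_comp_linear f g) (blin_comp_le f g).

Lemma norm_blin_comp U V W (f : blin V W) (g : blin U V) :
  `|blin_comp f g| <= `|f| * `|g|.
Proof.
by apply: opnorm_le => [|x]; [rewrite mulr_ge0 ?opnorm_ge0|exact: blin_comp_le].
Qed.

Lemma le_norm_blin V W (f : blin V W) x : `|f x| <= `|f| * `|x|.
Proof. exact: le_opnorm. Qed.

Lemma precomp_linear U V W (g : blin U V) :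
  linear (fun f : blin V W => blin_comp f g).
Proof. by move=> k x y; apply: blin_ext => z. Qed.

Lemma precomp_le U V W (g : blin U V) (f : blin V W) :
  `|blin_comp f g| <= `|g| * `|f|.
Proof. by rewrite mulrC norm_blin_comp. Qed.

Definition precomp U V W (g : blin U V) : blin (blin V W) (blin U W) :=
  bounded_blin (@precomp_linear U V W g) (@precomp_le U V W g).

Lemma blin_continuous V W (f : blin V W) : continuous f.
Proof.
move=> x; apply/cvgrPdist_lt => e e0 /=.
have d0 : 0 < `|f| + 1 by rewrite ltr_wpDl.
near=> y; rewrite -linearB (le_lt_trans (le_norm_blin _ _))//.
apply: (@le_lt_trans _ _ ((`|f| + 1) * `|x - y|)).
  by rewrite ler_wpM2r// lerDl.
rewrite mulrC -ltr_pdivlMr//; near: y.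
by apply: cvgr_dist_lt; rewrite ?divr_gt0.
Unshelve. all: by end_near. Qed.

Lemma blin_cvg V W (f : blin V W) (u : nat -> V) (x : V) :
  u n @[n --> \oo] --> x -> f (u n) @[n --> \oo] --> f x.
Proof. by move=> ux; apply: (cvg_comp _ _ ux); exact: blin_continuous. Qed.

Lemma closureP_norm V (B : set V) x :
  closure B x <-> forall e : R[i], 0 < e -> exists2 y, B y & `|x - y| < e.
Proof.
split=> [Bx e e0|Bx U].
  have [y [By]] := Bx _ (nbhsx_ballx x _ e0).
  by rewrite -ball_normE /= => xy; exists y.
move=> /nbhs_ballP[e /= e0 eU]; have [y By xy] := Bx _ e0.
by exists y; split=> //; apply: eU; rewrite -ball_normE.
Qed.

End Operators.

(** * Absolutely summable sequences *)

Section PartialSums.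
Variables (K : numFieldType) (V : normedModType K).
Implicit Types x y : nat -> V.

Definition psum x n : K := \sum_(k < n) `|x k|.

Lemma psum_ge0 x n : 0 <= psum x n.
Proof. exact: sumr_ge0. Qed.

Lemma psumD x y n : psum (fun k => x k + y k) n <= psum x n + psum y n.
Proof.
by rewrite /psum -big_split; apply: ler_sum => k _; exact: ler_normD.
Qed.

Lemma psumZ (a : K) x n : psum (fun k => a *: x k) n = `|a| * psum x n.
Proof. by rewrite /psum mulr_sumr; apply: eq_bigr => k _; rewrite normrZ. Qed.

Lemma le_psum x k : `|x k| <= psum x k.+1.
Proof. by rewrite /psum big_ord_recr /= lerDr sumr_ge0. Qed.

Lemma psum_cat x m n : (m <= n)%N ->
  psum x n - psum x m = \sum_(m <= k < n) `|x k|.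
Proof.
move=> mn; rewrite /psum -!(big_mkord xpredT (fun k => `|x k|)).
by rewrite (big_cat_nat (n := m) (p := n))//= addrAC subrr add0r.
Qed.

Lemma psum_homo x : {homo psum x : m n / (m <= n)%N >-> m <= n}.
Proof. by move=> m n mn; rewrite -subr_ge0 psum_cat// sumr_ge0. Qed.

Lemma norm_sum_le_psum x n : `|\sum_(k < n) x k| <= psum x n.
Proof. exact: ler_norm_sum. Qed.

Lemma dist_sum_le_psum x m n : (m <= n)%N ->
  `|\sum_(k < n) x k - \sum_(k < m) x k| <= psum x n - psum x m.
Proof.
move=> mn; rewrite psum_cat// -!(big_mkord xpredT (fun k => x k)).
rewrite (big_cat_nat (n := m) (p := n))//= addrAC subrr add0r.
exact: ler_norm_sum.
Qed.

Lemma psum_trunc x n p :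
  psum (fun k => x k - (if (k < n)%N then x k else 0)) p <=
  psum x (maxn n p) - psum x n.
Proof.
set y := fun k => _; have y0 q : (q <= n)%N -> psum y q = 0.
  move=> qn; rewrite /psum big1// => k _.
  by rewrite /y (leq_trans (ltn_ord k) qn) subrr normr0.
have [pn|/ltnW np] := leqP p n; first by rewrite subrr y0.
rewrite -[leLHS]subr0 -[X in _ - X <= _](y0 n (leqnn n)) !psum_cat//.
suff -> : \sum_(n <= k < p) `|y k| = \sum_(n <= k < p) `|x k| by [].
apply: eq_big_nat => k /andP[nk _].
by rewrite /y ltnNge nk subr0.
Qed.

Lemma psum_single k (v : V) n :
  psum (fun j => if j == k then v else 0) n <= `|v|.
Proof.
have [kn|nk] := ltnP k n.
  rewrite /psum (bigD1 (Ordinal kn))//= eqxx big1 ?addr0// => j jk.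
  by rewrite ifN ?normr0.
rewrite /psum big1// => j _; rewrite ifN ?normr0//.
by rewrite neq_ltn (leq_trans (ltn_ord j) nk).
Qed.

Lemma psum_dist_le x y z (b d : K) n :
  psum (fun k => y k - z k) n <= b ->
  (forall k, (k < n)%N -> `|x k - y k| <= d) ->
  psum (fun k => x k - z k) n <= d * n%:R + b.
Proof.
move=> yzb xyd; rewrite -[d * _](_ : \sum_(k < n) d = _); last first.
  by rewrite sumr_const card_ord mulr_natr.
rewrite (@le_trans _ _ (\sum_(k < n) (d + `|y k - z k|)))//; last first.
  by rewrite big_split /= lerD2l.
apply: ler_sum => k _; rewrite (le_trans (ler_distD (y k) _ _))//.
by rewrite lerD2r xyd.
Qed.

End PartialSums.

Section Ell1.
Variables (R : realType) (V : normedModType R[i]).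

Definition is_ell1 : {pred nat -> V} := [pred x : nat -> V |
  `[< exists M : R[i], forall n, psum x n <= M >]].

Lemma is_ell1_submod : submod_closed is_ell1.
Proof.
split.
  apply/asboolP; exists 0 => n.
  by rewrite /psum big1// => k _; rewrite normr0.
move=> a x y /asboolP[M xM] /asboolP[N yN]; apply/asboolP.
exists (`|a| * M + N) => n; apply: (le_trans (psumD _ _ _)).
by rewrite psumZ lerD// ler_wpM2l.
Qed.

HB.instance Definition _ :=
  GRing.isSubmodClosed.Build _ _ is_ell1 is_ell1_submod.

Record ell1 := Ell1 { ell1_fun :> nat -> V; ell1P : ell1_fun \in is_ell1 }.

HB.instance Definition _ := [isSub of ell1 for ell1_fun].
HB.instance Definition _ := [Choice of ell1 by <:].
HB.instance Definition _ := [SubChoice_isSubLmodule of ell1 by <:].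

Implicit Types x y : ell1.

Lemma ell1_ext x y : x =1 y -> x = y.
Proof. by move=> xy; apply/val_inj/funext. Qed.

Lemma ell1DE x y k : (x + y) k = x k + y k. Proof. by []. Qed.
Lemma ell1BE x y k : (x - y) k = x k - y k. Proof. by []. Qed.
Lemma ell1ZE (a : R[i]) x k : (a *: x) k = a *: x k. Proof. by []. Qed.

(** A supremum of partial sums exists among the real numbers, hence the cast. *)
Definition ell1norm x : R[i] :=
  (sup (range (fun n => complex.Re (psum x n))))%:C%C.

Lemma ell1_has_sup x : has_sup (range (fun n => complex.Re (psum x n))).
Proof.
split; first by exists (complex.Re (psum x 0)), 0%N.
have /asboolP[M xM] := ell1P x.
by exists (complex.Re M) => _ [n _ <-]; apply: Re_le.
Qed.

Lemma psum_le_ell1norm x n : psum x n <= ell1norm x.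
Proof.
rewrite -(ge0_ReK (psum_ge0 x n)) lecR.
by apply: (sup_upper_bound (ell1_has_sup x)); exists n.
Qed.

Lemma ell1norm_le x (M : R[i]) :
  (forall n, psum x n <= M) -> ell1norm x <= M.
Proof.
move=> xM; have M0 : 0 <= M := le_trans (psum_ge0 x 0) (xM 0%N).
rewrite -(ge0_ReK M0) lecR; apply: ge_sup; first by have [] := ell1_has_sup x.
by move=> _ [n _ <-]; apply: Re_le.
Qed.

Lemma ell1norm_ge0 x : 0 <= ell1norm x.
Proof. exact: le_trans (psum_ge0 x 0) (psum_le_ell1norm x 0). Qed.

Lemma le_ell1norm x k : `|x k| <= ell1norm x.
Proof. exact: le_trans (le_psum x k) (psum_le_ell1norm x k.+1). Qed.

Lemma ell1normD x y : ell1norm (x + y) <= ell1norm x + ell1norm y.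
Proof.
apply: ell1norm_le => n; apply: (le_trans (psumD _ _ _)).
by rewrite lerD ?psum_le_ell1norm.
Qed.

Lemma ell1normZ_le (a : R[i]) x : ell1norm (a *: x) <= `|a| * ell1norm x.
Proof.
apply: ell1norm_le => n.
by rewrite [X in X <= _]psumZ ler_wpM2l ?psum_le_ell1norm.
Qed.

Lemma ell1normZ (a : R[i]) x : ell1norm (a *: x) = `|a| * ell1norm x.
Proof.
apply/eqP; rewrite eq_le ell1normZ_le /=.
have [->|a0] := eqVneq a 0; first by rewrite normr0 mul0r ell1norm_ge0.
rewrite -ler_pdivlMl ?normr_gt0// -normfV.
by rewrite -{1}[x](scalerK a0) ell1normZ_le.
Qed.

Lemma ell1norm_eq0 x : ell1norm x = 0 -> x = 0.
Proof.
move=> x0; apply: ell1_ext => k; apply/normr0_eq0/eqP.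
by rewrite eq_le normr_ge0 andbT -x0 le_ell1norm.
Qed.

HB.instance Definition _ :=
  Lmodule_isNormed.Build R[i] ell1 ell1normD ell1normZ ell1norm_eq0.

Lemma psum_le_norm x n : psum x n <= `|x|.
Proof. exact: psum_le_ell1norm. Qed.

Lemma norm_ell1_le x (M : R[i]) : (forall n, psum x n <= M) -> `|x| <= M.
Proof. exact: ell1norm_le. Qed.

Lemma ell1_tail x (e : R[i]) : 0 < e ->
  exists m, forall n, (m <= n)%N -> `|x| - psum x n < e.
Proof.
move=> e0; have eE := ge0_ReK (ltW e0).
have e0' : 0 < complex.Re e by rewrite -ltcR eE.
have [_ [m _ <-] xm] := sup_adherent e0' (ell1_has_sup x).
exists m => n mn; move: xm; rewrite -ltcR rmorphB /= eE.
rewrite (ge0_ReK (psum_ge0 x m)) !ltrBlDr => xm.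
by rewrite (lt_le_trans xm)// addrC lerD2l psum_homo.
Qed.

Lemma single_is_ell1 k (v : V) : (fun j => if j == k then v else 0) \in is_ell1.
Proof. by apply/asboolP; exists `|v| => n; exact: psum_single. Qed.

Lemma single_linear k : linear (fun v => Ell1 (single_is_ell1 k v)).
Proof.
move=> a u v; apply: ell1_ext => j; rewrite ell1DE ell1ZE /=.
by case: eqP => // _; rewrite scaler0 addr0.
Qed.

Lemma single_le k v : `|Ell1 (single_is_ell1 k v)| <= 1 * `|v|.
Proof. by rewrite mul1r; apply: norm_ell1_le => n; exact: psum_single. Qed.

Definition single k : blin V ell1 :=
  bounded_blin (single_linear k) (single_le k).

Lemma norm_single k v : `|single k v| <= `|v|.
Proof. by have := single_le k v; rewrite mul1r. Qed.

Lemma ell1_coord_linear k : linear (fun x : ell1 => x k).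
Proof. by []. Qed.

Lemma ell1_coord_le k (x : ell1) : `|x k| <= 1 * `|x|.
Proof. by rewrite mul1r le_ell1norm. Qed.

Definition ell1_coord k : blin ell1 V :=
  bounded_blin (ell1_coord_linear k) (ell1_coord_le k).

Lemma sum_singleE x n j :
  (\sum_(k < n) single k (x k)) j = if (j < n)%N then x j else 0.
Proof.
rewrite -[LHS]/(ell1_coord j _) linear_sum /=.
have [jn|nj] := ltnP j n.
  rewrite (bigD1 (Ordinal jn))//= eqxx big1 ?addr0// => i ij.
  by rewrite ifN// eq_sym.
rewrite big1// => i _; rewrite ifN//.
by rewrite neq_ltn (leq_trans (ltn_ord i) nj) orbT.
Qed.

Lemma cvg_sum_single x : \sum_(k < n) single k (x k) @[n --> \oo] --> x.
Proof.
apply/cvgrPdist_le => e e0; have [m xm] := ell1_tail x e0.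
exists m => // n /= mn; apply: norm_ell1_le => p.
rewrite (_ : (x - _ : nat -> V) =
             fun k => x k - (if (k < n)%N then x k else 0)).
  apply: (le_trans (psum_trunc x n p)); apply: le_trans (ltW (xm n mn)).
  by rewrite lerD2r psum_le_norm.
by apply/funext => k; rewrite ell1BE sum_singleE.
Qed.

(** The finitely supported sequences are dense in l^1, so a bounded operator out
    of l^1 is determined by its restrictions to the coordinate subspaces. *)
Lemma ell1_blin_ext (W : normedModType R[i]) (f g : blin ell1 W) :
  (forall k v, f (single k v) = g (single k v)) -> f = g.
Proof.
move=> fg; apply: blin_ext => x.
have cv (h : blin ell1 W) :
    limn (fun n => h (\sum_(k < n) single k (x k))) = h x.
  by apply: cvg_lim; [exact: norm_hausdorff|exact/blin_cvg/cvg_sum_single].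
rewrite -(cv f) (_ : (fun n => _) = fun n => g (\sum_(k < n) single k (x k))).
  exact: cv.
by apply/funext => n; rewrite !linear_sum; apply: eq_bigr => k _; exact: fg.
Qed.

End Ell1.

Section Ell1Complete.
Variables (R : realType) (V : banachType R).

Lemma ell1_complete (F : set_system (ell1 V)) :
  ProperFilter F -> cauchy F -> cvg F.
Proof.
move=> FF /cauchy_ballP Fc.
have Fc2 (e : R[i]) : 0 < e -> exists Q : set (ell1 V) * set (ell1 V),
    [/\ F Q.1, F Q.2 & forall x y, Q.1 x -> Q.2 y -> `|x - y| <= e].
  move=> e0; have [[Q1 Q2] /= [FQ1 FQ2] Q] := Fc _ e0.
  exists (Q1, Q2); split => //= x y Qx Qy; apply/ltW.
  by have := Q (x, y) (conj Qx Qy); rewrite /= -ball_normE.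
have cv k : cvg (ell1_coord V k @ F).
  apply/cauchy_cvgP/cauchy_ballP => e e0.
  have e2 : 0 < e / 2 by rewrite divr_gt0.
  have [[Q1 Q2] /= [FQ1 FQ2 Q]] := Fc2 _ e2.
  exists (ell1_coord V k @` Q1, ell1_coord V k @` Q2) => /=.
    by split; [apply: (@filterS _ F _ _ _ _ FQ1)|
      apply: (@filterS _ F _ _ _ _ FQ2)] => x Qx; exists x.
  move=> [_ _] /= [[x Qx <-] [y Qy <-]].
  rewrite -ball_normE /= -[X in `|X|]/((x - y) k).
  rewrite (le_lt_trans (le_ell1norm _ _))// (le_lt_trans (Q _ _ Qx Qy))//.
  by rewrite ltr_pdivrMr// ltr_pMr// ltr1n.
pose g k := lim (ell1_coord V k @ F).
have gP k : ell1_coord V k @ F --> g k by exact: cv.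
have key (e : R[i]) : 0 < e ->
    F [set x : ell1 V | forall n, psum (fun k => g k - x k) n <= e].
  move=> e0; have [[Q1 Q2] /= [FQ1 FQ2 Q]] := Fc2 _ e0.
  apply: (@filterS _ F _ _ _ _ FQ1) => x Qx n; apply/ler_addgt0Pr => d d0.
  pose d' := d / n.+1%:R.
  have d'0 : 0 < d' by rewrite divr_gt0.
  have Fd : F [set y : ell1 V | forall k : 'I_n, `|g k - y k| <= d'].
    apply: filter_forall => k; have /cvgrPdist_le/(_ _ d'0) := gP k; exact.
  have [y [Qy /= yd]] := filter_ex (filterI FQ2 Fd).
  have xy : psum (fun k => y k - x k) n <= e.
    by rewrite (le_trans (psum_le_norm (y - x) n))// distrC Q.
  apply: (le_trans (psum_dist_le xy (fun k kn => yd (Ordinal kn)))).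
  rewrite addrC lerD2l /d' mulrAC ler_pdivrMr//.
  by rewrite ler_wpM2l ?ler_nat// ltW.
have gell : g \in @is_ell1 R V.
  apply/asboolP; have [x xg] := filter_ex (key 1 ltr01).
  exists (1 + `|x|) => n; have := psumD (fun k => g k - x k) x n.
  rewrite (_ : (fun k => _) = g); last by apply/funext => k; rewrite subrK.
  by move/le_trans; apply; rewrite lerD// psum_le_norm.
apply/cvg_ex; exists (Ell1 gell); apply/cvgrPdist_le => e e0.
apply: (@filterS _ F _ _ _ _ (key _ e0)) => x xe /=.
exact: norm_ell1_le.
Qed.

HB.instance Definition _ := Uniform_isComplete.Build (ell1 V) ell1_complete.

Lemma ell1_cvg (x : ell1 V) : cvg (\sum_(k < n) x k @[n --> \oo]).
Proof.
apply/cauchy_cvgP/cauchy_exP => e e0.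
have [m xm] := ell1_tail x e0.
exists (\sum_(k < m) x k); exists m => // n /= mn.
rewrite -ball_normE /= distrC (le_lt_trans (dist_sum_le_psum x mn))//.
by apply: le_lt_trans (xm m (leqnn m)); rewrite lerD2r psum_le_norm.
Qed.

Definition ell1_sum_fun (x : ell1 V) := lim (\sum_(k < n) x k @[n --> \oo]).

Lemma ell1_sumP (x : ell1 V) :
  \sum_(k < n) x k @[n --> \oo] --> ell1_sum_fun x.
Proof. exact: ell1_cvg. Qed.

Lemma ell1_sum_linear : linear ell1_sum_fun.
Proof.
move=> a x y; apply: (cvg_lim (@norm_hausdorff _ _)).
rewrite (_ : (fun n => _) =
             fun n => a *: (\sum_(k < n) x k) + \sum_(k < n) y k).
  by apply: cvgD; [apply: cvgZl_tmp|]; exact: ell1_sumP.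
by apply/funext => n; rewrite scaler_sumr -big_split.
Qed.

Lemma ell1_sum_le x : `|ell1_sum_fun x| <= 1 * `|x|.
Proof.
rewrite mul1r; apply/ler_addgt0Pr => e e0.
have /cvgrPdist_le/(_ _ e0)[n _ /(_ n (leqnn n)) /= xn] := @ell1_sumP x.
rewrite -[ell1_sum_fun x](subrK (\sum_(k < n) x k)) addrC.
rewrite (le_trans (ler_normD _ _))// lerD//.
exact: le_trans (norm_sum_le_psum x n) (psum_le_norm x n).
Qed.

Definition ell1_sum : blin (ell1 V) V :=
  bounded_blin ell1_sum_linear ell1_sum_le.

Lemma ell1_sum_single k v : ell1_sum (single V k v) = v.
Proof.
apply: (cvg_lim (@norm_hausdorff _ _)); apply: cvg_near_cst.
exists k.+1 => // n /= kn.
rewrite (bigD1 (Ordinal kn))//= eqxx big1 ?addr0// => j jk.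
by rewrite ifN.
Qed.

End Ell1Complete.

Section Ell1Maps.
Variable R : realType.
Implicit Types U V W : normedModType R[i].

Lemma psum_scale (K : numFieldType) (E F : normedModType K) (x : nat -> E)
    (y : nat -> F) (M : K) n :
  (forall k, `|y k| <= M * `|x k|) -> psum y n <= M * psum x n.
Proof. by move=> xy; rewrite /psum mulr_sumr; apply: ler_sum. Qed.

Section Diagonal.
Variables (V W : normedModType R[i]) (T : nat -> blin V W) (M : R[i]).
Hypothesis TM : forall k, `|T k| <= M.

Lemma ell1_diag_coord_le k (v : V) : `|T k v| <= M * `|v|.
Proof. by apply: (le_trans (le_norm_blin _ _)); rewrite ler_wpM2r. Qed.

Lemma ell1_diag_psum (x : ell1 V) n : psum (fun k => T k (x k)) n <= M * `|x|.
Proof.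
apply: le_trans (psum_scale _ (fun k => ell1_diag_coord_le k (x k))) _.
by rewrite ler_wpM2l ?psum_le_norm// (le_trans _ (TM 0)).
Qed.

Lemma ell1_diag_is_ell1 (x : ell1 V) : (fun k => T k (x k)) \in @is_ell1 R W.
Proof. by apply/asboolP; exists (M * `|x|) => n; exact: ell1_diag_psum. Qed.

Lemma ell1_diag_linear : linear (fun x => Ell1 (ell1_diag_is_ell1 x)).
Proof. by move=> a x y; apply: ell1_ext => k /=; rewrite linearP. Qed.

Lemma ell1_diag_le x : `|Ell1 (ell1_diag_is_ell1 x)| <= M * `|x|.
Proof. by apply: norm_ell1_le => n; exact: ell1_diag_psum. Qed.

Definition ell1_diag : blin (ell1 V) (ell1 W) :=
  bounded_blin ell1_diag_linear ell1_diag_le.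

Lemma ell1_diag_single k v : ell1_diag (single V k v) = single W k (T k v).
Proof.
by apply: ell1_ext => j /=; case: eqP => [->|_]; rewrite ?linear0.
Qed.

End Diagonal.

Definition ell1_map V W (T : blin V W) : blin (ell1 V) (ell1 W) :=
  ell1_diag (fun=> lexx `|T|).

Lemma ell1_map_single V W (T : blin V W) k v :
  ell1_map T (single V k v) = single W k (T v).
Proof. exact: ell1_diag_single. Qed.

Lemma norm_ell1_map V W (T : blin V W) x : `|ell1_map T x| <= `|T| * `|x|.
Proof. exact: ell1_diag_le. Qed.

(** The universal property of l^1(V): its bounded operators to a Banach space
    are the bounded sequences of operators out of V. Completeness of the target
    makes the series converge. *)
Definition ell1_lift V (W : banachType R) (T : nat -> blin V W) (M : R[i])
    (TM : forall k, `|T k| <= M) : blin (ell1 V) W :=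
  blin_comp (ell1_sum W) (ell1_diag TM).

Lemma ell1_lift_single V (W : banachType R) (T : nat -> blin V W) (M : R[i])
  (TM : forall k, `|T k| <= M) k v : ell1_lift TM (single V k v) = T k v.
Proof.
rewrite -[LHS]/(ell1_sum W (ell1_diag TM (single V k v))).
by rewrite ell1_diag_single ell1_sum_single.
Qed.

Lemma norm_ell1_lift V (W : banachType R) (T : nat -> blin V W) (M : R[i])
  (TM : forall k, `|T k| <= M) x : `|ell1_lift TM x| <= M * `|x|.
Proof.
rewrite (le_trans (ell1_sum_le _))// mul1r; exact: ell1_diag_le.
Qed.

End Ell1Maps.

Section Line.
Variables (R : realType) (V : normedModType R[i]).

Lemma line_linear (v : V) : linear (fun a : Cspace R => (a : R[i]) *: v).
Proof.
move=> k a b; rewrite -[LHS]/((k * (a : R[i]) + (b : R[i])) *: v).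
by rewrite scalerDl -scalerA.
Qed.

Lemma line_le (v : V) (a : Cspace R) : `|(a : R[i]) *: v| <= `|v| * `|a|.
Proof. by rewrite normrZ mulrC. Qed.

Definition line_of (v : V) : blin (Cspace R) V :=
  bounded_blin (line_linear v) (line_le v).

Lemma line_of_linear : linear line_of.
Proof.
move=> k v w; apply: blin_ext => a.
rewrite -[RHS]/(k *: ((a : R[i]) *: v) + (a : R[i]) *: w).
by rewrite [LHS]scalerDr !scalerA [in RHS]mulrC.
Qed.

Lemma line_of_le v : `|line_of v| <= 1 * `|v|.
Proof. by rewrite mul1r; apply: opnorm_le => // a; exact: line_le. Qed.

(** The identification of V with the operators from the scalars to V. *)
Definition line : blin V (blin (Cspace R) V) :=
  bounded_blin line_of_linear line_of_le.

Lemma norm_line : `|line| <= 1.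
Proof. by apply: opnorm_le => // v; exact: line_of_le. Qed.

End Line.

Section LiftFamily.
Variables (R : realType) (X V : normedModType R[i]) (W : banachType R).
Variables (f : nat -> blin X (blin V W)) (M : R[i]).
Hypothesis fM : forall k, `|f k| <= M.

Lemma lift_family_term_le x k : `|f k x| <= M * `|x|.
Proof. by rewrite (le_trans (le_norm_blin _ _))// ler_wpM2r. Qed.

Definition lift_family_fun x : blin (ell1 V) W :=
  ell1_lift (lift_family_term_le x).

Lemma lift_family_single x k v : lift_family_fun x (single V k v) = f k x v.
Proof. exact: ell1_lift_single. Qed.

Lemma lift_family_linear : linear lift_family_fun.
Proof.
move=> a x y; apply: ell1_blin_ext => k v.
by rewrite blinDE blinZE !lift_family_single linearP.
Qed.

Lemma lift_family_le x : `|lift_family_fun x| <= M * `|x|.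
Proof.
apply: opnorm_le => [|y]; last exact: norm_ell1_lift.
by rewrite mulr_ge0// (le_trans _ (fM 0)).
Qed.

(** Both models of bounded sequences used below, the operators from l^1 to Y and
    the dual of l^1(Y), consist of operators out of an l^1 space; this is how a
    bounded sequence of morphisms becomes one morphism into them. *)
Definition lift_family : blin X (blin (ell1 V) W) :=
  bounded_blin lift_family_linear lift_family_le.

End LiftFamily.

Section Postcomp.
Variables (R : realType) (U V W : normedModType R[i]) (f : blin V W).

Lemma postcomp_linear : linear (fun g : blin U V => blin_comp f g).
Proof. by move=> k x y; apply: blin_ext => z /=; rewrite linearP. Qed.

Definition postcomp : blin (blin U V) (blin U W) :=
  bounded_blin postcomp_linear (norm_blin_comp f).

End Postcomp.

Section Evaluation.
Variables (R : realType) (V W : normedModType R[i]).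

Lemma eval_linear (v : V) : linear (fun g : blin V W => g v).
Proof. by []. Qed.

Lemma eval_le (v : V) (g : blin V W) : `|g v| <= `|v| * `|g|.
Proof. by rewrite mulrC le_norm_blin. Qed.

Definition eval v : blin (blin V W) W :=
  bounded_blin (eval_linear v) (eval_le v).

End Evaluation.

(** * Almost surjective operators *)

Lemma psum_geometric (K : numFieldType) (V : normedModType K) (x : nat -> V)
    (C : K) n :
  (forall k, `|x k| <= C * 2^-1 ^+ k) ->
  psum x n + 2 * C * 2^-1 ^+ n <= 2 * C.
Proof.
move=> xC; elim: n => [|n IH]; first by rewrite /psum big_ord0 add0r mulr1.
apply: le_trans IH; rewrite /psum big_ord_recr /= -addrA lerD2l.
rewrite (_ : 2 * C * 2^-1 ^+ n = C * 2^-1 ^+ n + 2 * C * 2^-1 ^+ n.+1).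
  by rewrite lerD2r.
rewrite exprS mulrA (mulrAC 2 C 2^-1) divff ?mul1r ?pnatr_eq0//.
by rewrite -mulrA mulr_natl mulr2n.
Qed.

Lemma complex_archi (R : realType) (M : R[i]) :
  0 <= M -> exists n : nat, M <= n%:R.
Proof.
move=> M0; exists (Num.bound (complex.Re M)).
rewrite -(ge0_ReK M0) -[leRHS](rmorph_nat (real_complex R)) lecR ltW//.
by rewrite archi_boundP// -lecR ge0_ReK.
Qed.

Section AlmostOnto.
Variables (R : realType) (V : banachType R) (W : normedModType R[i]).
Variables (T : blin V W) (S : set V) (Z : set W).
Hypotheses (S0 : S 0) (SD : forall x y, S x -> S y -> S (x + y)).
Hypothesis SZ : forall (a : R[i]) x, S x -> S (a *: x).
Hypothesis Sclosed : forall (u : nat -> V) x,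
  (forall n, S (u n)) -> u n @[n --> \oo] --> x -> S x.
Hypothesis ZB : forall x y, Z x -> Z y -> Z (x - y).
Hypothesis ZZ : forall (a : R[i]) x, Z x -> Z (a *: x).
Hypothesis ZT : forall x, S x -> Z (T x).
Hypothesis approx : forall z : nat -> W,
  (forall k, Z (z k)) -> (forall k, `|z k| <= 1) ->
  exists (x : nat -> V) (M : R[i]),
    forall k, [/\ S (x k), `|x k| <= M & `|z k - T (x k)| <= 2^-1].

(** Were there no uniform bound, a sequence of elements needing larger and
    larger approximants would contradict the hypothesis on sequences. *)
Lemma approx_uniform : exists C : R[i], forall z, Z z -> `|z| <= 1 ->
  exists x, [/\ S x, `|x| <= C & `|z - T x| <= 2^-1].
Proof.
apply: contrapT => noC.
have bad (n : nat) : exists z, [/\ Z z, `|z| <= 1 &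
    ~ exists x, [/\ S x, `|x| <= n%:R & `|z - T x| <= 2^-1]].
  apply: contrapT => nobad; apply: noC; exists n%:R => z Zz z1.
  by apply: contrapT => nox; apply: nobad; exists z.
have [z zP] := choice bad.
have Zz k : Z (z k) by have [] := zP k.
have z1 k : `|z k| <= 1 by have [] := zP k.
have [x [M xP]] := approx Zz z1.
have M0 : 0 <= M by have [_ /(le_trans _)-> //] := xP 0%N.
have [n Mn] := complex_archi M0.
have [_ _ []] := zP n; exists (x n); have [Sx xM zx] := xP n.
by split=> //; exact: le_trans Mn.
Qed.

(** The iteration of the open mapping theorem: each step halves the error, so
    that the corrections form a geometric series. *)
Lemma almost_onto z : Z z -> exists2 x, S x & T x = z.
Proof.
have [C CP] := approx_uniform.
have /choice[phi phiP] z' : exists x, Z z' -> `|z'| <= 1 ->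
    [/\ S x, `|x| <= C & `|z' - T x| <= 2^-1].
  have [[Zz z1]|nz] := pselect (Z z' /\ `|z'| <= 1).
    by have [x xP] := CP _ Zz z1; exists x.
  by exists 0 => Zz z1; case: nz.
have unit w : Z w -> `|w| <= 1 -> exists2 x, S x & T x = w.
  move=> Zw w1.
  (* The error left after j steps, multiplied by 2^j. *)
  pose zs := fix zs j :=
    if j is j'.+1 then 2 *: (zs j' - T (phi (zs j'))) else w.
  have zsP j : Z (zs j) /\ `|zs j| <= 1.
    elim: j => [//|j [Zj j1]] /=; have [Sx _ dx] := phiP _ Zj j1.
    split; first by apply/ZZ/ZB => //; exact: ZT.
    rewrite normrZ ger0_norm//; apply: le_trans (ler_wpM2l _ dx) _ => //.
    by rewrite divff ?pnatr_eq0.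
  have phizs j := phiP _ (zsP j).1 (zsP j).2.
  pose xs j := 2^-1 ^+ j *: phi (zs j).
  have half0 : 0 <= (2^-1 : R[i]) by rewrite invr_ge0.
  have xsC j : `|xs j| <= C * 2^-1 ^+ j.
    rewrite normrZ mulrC ger0_norm ?exprn_ge0// ler_wpM2r ?exprn_ge0//.
    by have [] := phizs j.
  have C0 : 0 <= C by have [_ /(le_trans _)-> //] := phizs 0%N.
  have summable (E : normedModType R[i]) (c : R[i]) (y : nat -> E) : 0 <= c ->
      (forall k, `|y k| <= c * 2^-1 ^+ k) -> y \in @is_ell1 R E.
    move=> c0 yc; apply/asboolP; exists (2 * c) => n.
    apply: le_trans (psum_geometric n yc); rewrite lerDl.
    by rewrite !mulr_ge0 ?exprn_ge0.
  pose x : ell1 V := Ell1 (summable _ _ _ C0 xsC).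
  have zsC j : `|2^-1 ^+ j *: zs j| <= 1 * 2^-1 ^+ j.
    rewrite normrZ mulrC ger0_norm ?exprn_ge0// ler_wpM2r ?exprn_ge0//.
    by have [] := zsP j.
  (* The actual errors are summable, hence tend to 0. *)
  pose r : ell1 W := Ell1 (summable _ _ _ ler01 zsC).
  have rE n : T (\sum_(k < n) x k) = w - r n.
    elim: n => [|n IH]; first by rewrite big_ord0 linear0 /= scale1r subrr.
    have Tx : T (x n) = 2^-1 ^+ n *: T (phi (zs n)) by rewrite linearZ.
    rewrite big_ord_recr linearD [X in X + _]IH [X in _ + X]Tx /=.
    rewrite exprSr scalerA.
    by rewrite -mulrA mulVf ?pnatr_eq0// mulr1 scalerBr opprB addrA addrAC.
  exists (ell1_sum V x).
    apply: (Sclosed _ (@ell1_sumP _ _ x)) => n; elim: n => [|n IH].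
      by rewrite big_ord0.
    by rewrite big_ord_recr; apply/SD/SZ => //; have [] := phizs n.
  have xT : limn (fun n => T (\sum_(k < n) x k)) = T (ell1_sum V x).
    by apply: cvg_lim; [exact: norm_hausdorff|exact/blin_cvg/ell1_sumP].
  rewrite -xT; apply: cvg_lim; first exact: norm_hausdorff.
  apply/cvgrPdist_lt => e e0; have [m rm] := ell1_tail r e0.
  exists m => // n /= /rm; apply: le_lt_trans.
  rewrite rE opprB addrC subrK (le_trans (_ : _ <= psum r n.+1 - psum r n))//.
    by rewrite /psum big_ord_recr /= addrAC subrr add0r.
  by rewrite lerD2r psum_le_norm.
move=> Zz; have [->|z0] := eqVneq z 0; first by exists 0; rewrite ?linear0.
have nz0 : `|z| != 0 by rewrite normr_eq0.
have [|x Sx Tx] := unit (`|z|^-1 *: z) (ZZ _ Zz).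
  by rewrite normrZ normfV normr_id mulVf.
exists (`|z| *: x); first exact: SZ.
by rewrite linearZ /= Tx scalerA divff// scale1r.
Qed.

End AlmostOnto.

(** * Banach modules *)

Section BuildModules.
Variables (R : realType) (A : banachAlgebra R) (V : banachType R).

Section Left.
Variable act : A -> V -> V.
Hypothesis act_bilinear : bilinear_for *:%R *:%R act.
Hypothesis actA : forall a b x, act (ba_mul A a b) x = act a (act b x).
Hypothesis act_bound : exists2 c : R[i], 0 <= c &
  forall a x, `|act a x| <= c * `|a| * `|x|.

Definition left_action : {bilinear A -> V -> V} :=
  HB.pack act (bilinear_isBilinear.Build R[i] A V V *:%R *:%R act act_bilinear).

Lemma left_action_continuous :
  continuous (fun p : A * V => left_action p.1 p.2).
Proof.
have [c c0 cP] := act_bound.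
exact: (@bounded_bilinear_continuous _ _ _ _ left_action c c0 cP).
Qed.

Definition left_module : leftModule A :=
  @LeftModule R A V left_action actA left_action_continuous.

End Left.

Section Right.
Variable act : V -> A -> V.
Hypothesis act_bilinear : bilinear_for *:%R *:%R act.
Hypothesis actA : forall x a b, act x (ba_mul A a b) = act (act x a) b.
Hypothesis act_bound : exists2 c : R[i], 0 <= c &
  forall x a, `|act x a| <= c * `|x| * `|a|.

Definition right_action : {bilinear V -> A -> V} :=
  HB.pack act (bilinear_isBilinear.Build R[i] V A V *:%R *:%R act act_bilinear).

Lemma right_action_continuous :
  continuous (fun p : V * A => right_action p.1 p.2).
Proof.
have [c c0 cP] := act_bound.
exact: (@bounded_bilinear_continuous _ _ _ _ right_action c c0 cP).
Qed.

Definition right_module : rightModule A :=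
  @RightModule R A V right_action actA right_action_continuous.

End Right.
End BuildModules.

Section ActionBounds.
Variables (R : realType) (A : banachAlgebra R).

Lemma lm_act_bound (Y : leftModule A) : exists2 c : R[i], 0 <= c &
  forall a (y : Y), `|lm_act Y a y| <= c * `|a| * `|y|.
Proof.
have [c c0 cP] := bilinear_schwarz (@lm_cont _ _ Y).
by exists c => //; exact: ltW.
Qed.

Lemma rm_act_bound (Y : rightModule A) : exists2 c : R[i], 0 <= c &
  forall (y : Y) a, `|rm_act Y y a| <= c * `|y| * `|a|.
Proof.
have [c c0 cP] := bilinear_schwarz (@rm_cont _ _ Y).
by exists c => //; exact: ltW.
Qed.

End ActionBounds.

Section Kernel.
Variables (R : realType) (V W : banachType R) (T : blin V W).

Definition in_ker : {pred V} := [pred x : V | T x == 0].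

Lemma in_ker_submod : submod_closed in_ker.
Proof.
split; first by rewrite inE /= linear0.
move=> a x y; rewrite !inE /= => /eqP Tx /eqP Ty.
have -> : T (a *: x + y) = a *: T x + T y by exact: linearP.
by rewrite Tx Ty scaler0 addr0.
Qed.

HB.instance Definition _ :=
  GRing.isSubmodClosed.Build _ _ in_ker in_ker_submod.

Record ker := Ker { ker_val :> V; kerP : ker_val \in in_ker }.

HB.instance Definition _ := [isSub of ker for ker_val].
HB.instance Definition _ := [Choice of ker by <:].
HB.instance Definition _ := [SubChoice_isSubLmodule of ker by <:].

Definition kernorm (x : ker) : R[i] := `|ker_val x|.

Lemma kernormD x y : kernorm (x + y) <= kernorm x + kernorm y.
Proof. exact: ler_normD. Qed.

Lemma kernormZ (a : R[i]) x : kernorm (a *: x) = `|a| * kernorm x.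
Proof. exact: normrZ. Qed.

Lemma kernorm_eq0 x : kernorm x = 0 -> x = 0.
Proof. by move/normr0_eq0 => x0; apply: val_inj. Qed.

HB.instance Definition _ :=
  Lmodule_isNormed.Build R[i] ker kernormD kernormZ kernorm_eq0.

Lemma ker_complete (F : set_system ker) : ProperFilter F -> cauchy F -> cvg F.
Proof.
move=> FF /cauchy_ballP Fc.
have cv : cvg (ker_val @ F).
  apply/cauchy_cvgP/cauchy_ballP => e e0.
  have [[Q1 Q2] /= [FQ1 FQ2] Q] := Fc _ e0.
  exists (ker_val @` Q1, ker_val @` Q2) => /=.
    by split; [apply: (@filterS _ F _ _ _ _ FQ1)|
      apply: (@filterS _ F _ _ _ _ FQ2)] => x Qx; exists x.
  move=> [_ _] /= [[x Qx <-] [y Qy <-]].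
  by have := Q (x, y) (conj Qx Qy); rewrite /= -!ball_normE.
have l0 : lim (ker_val @ F) \in in_ker.
  rewrite inE /=; apply/eqP.
  have : T (ker_val x) @[x --> F] --> T (lim (ker_val @ F)).
    by apply: (cvg_comp _ _ cv); exact: blin_continuous.
  move/(cvg_lim (@norm_hausdorff _ _)) => <-.
  rewrite (_ : (fun x => _) = fun=> 0); first exact: lim_cst.
  by apply/funext => x; apply/eqP/kerP.
apply/cvg_ex; exists (Ker l0); apply/cvgrPdist_le => e e0.
by move/cvgrPdist_le: cv => /(_ _ e0).
Qed.

HB.instance Definition _ := Uniform_isComplete.Build ker ker_complete.

Lemma ker_val_linear : linear ker_val. Proof. by []. Qed.

Lemma ker_val_le (x : ker) : `|ker_val x| <= 1 * `|x|.
Proof. by rewrite mul1r. Qed.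

Definition ker_incl : blin ker V := bounded_blin ker_val_linear ker_val_le.

End Kernel.

Section KernelModule.
Variables (R : realType) (A : banachAlgebra R) (Y : leftModule A).
Variables (W : banachType R) (T : blin Y W).
Hypothesis stable : forall a y, T y = 0 -> T (lm_act Y a y) = 0.

Lemma ker_act_subproof a (x : ker T) : lm_act Y a (ker_val x) \in in_ker T.
Proof. by rewrite inE /=; apply/eqP/stable/eqP/kerP. Qed.

Definition ker_act a (x : ker T) : ker T := Ker (ker_act_subproof a x).

Lemma ker_act_bilinear : bilinear_for *:%R *:%R ker_act.
Proof.
split=> [x k a b|a k x y]; apply: val_inj => /=.
  by rewrite linearPl.
by rewrite linearPr.
Qed.

Lemma ker_actA a b (x : ker T) :
  ker_act (ba_mul A a b) x = ker_act a (ker_act b x).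
Proof. by apply: val_inj; exact: lm_actA. Qed.

Lemma ker_act_bound : exists2 c : R[i], 0 <= c &
  forall a (x : ker T), `|ker_act a x| <= c * `|a| * `|x|.
Proof.
by have [c c0 cP] := lm_act_bound Y; exists c => // a x; exact: cP.
Qed.

Definition ker_module : leftModule A :=
  left_module ker_act_bilinear ker_actA ker_act_bound.

End KernelModule.

Section L1Module.
Variables (R : realType) (A : banachAlgebra R).

Section Left.
Variable Y : leftModule A.

Lemma lm_mul_le a : exists M : R[i], forall y, `|lm_act Y a y| <= M * `|y|.
Proof. by have [c _ cP] := lm_act_bound Y; exists (c * `|a|). Qed.

Lemma lm_mul_subproof a : lm_act Y a \in @is_blin R Y Y.
Proof.
by have [M] := lm_mul_le a; apply: bounded_is_blin; exact: linearPr.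
Qed.

Definition lm_mul a : blin Y Y := Blin (lm_mul_subproof a).

Definition l1_act a (y : ell1 Y) : ell1 Y := ell1_map (lm_mul a) y.

Lemma l1_act_bilinear : bilinear_for *:%R *:%R l1_act.
Proof.
split=> [y k a b|a k x y]; apply: ell1_ext => j /=.
  by rewrite linearPl.
by rewrite linearPr.
Qed.

Lemma l1_actA a b y : l1_act (ba_mul A a b) y = l1_act a (l1_act b y).
Proof. by apply: ell1_ext => j; exact: lm_actA. Qed.

Lemma lm_mul_bound : exists2 c : R[i], 0 <= c &
  forall a, `|lm_mul a| <= c * `|a|.
Proof.
have [c c0 cP] := lm_act_bound Y; exists c => // a.
by apply: opnorm_le; [rewrite mulr_ge0|exact: cP].
Qed.

Lemma l1_act_bound : exists2 c : R[i], 0 <= c &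
  forall a y, `|l1_act a y| <= c * `|a| * `|y|.
Proof.
have [c c0 cP] := lm_mul_bound; exists c => // a y.
by rewrite (le_trans (norm_ell1_map _ _))// ler_wpM2r.
Qed.

Definition l1_module : leftModule A :=
  left_module l1_act_bilinear l1_actA l1_act_bound.

Definition linf_act a (g : blin (ell1 (Cspace R)) Y) := blin_comp (lm_mul a) g.

Lemma linf_act_bilinear : bilinear_for *:%R *:%R linf_act.
Proof.
split=> [y k a b|a k x y]; apply: blin_ext => j /=.
  by rewrite linearPl.
by rewrite linearPr.
Qed.

Lemma linf_actA a b y : linf_act (ba_mul A a b) y = linf_act a (linf_act b y).
Proof. by apply: blin_ext => j; exact: lm_actA. Qed.

Lemma linf_act_bound : exists2 c : R[i], 0 <= c &
  forall a y, `|linf_act a y| <= c * `|a| * `|y|.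
Proof.
have [c c0 cP] := lm_mul_bound; exists c => // a y.
by rewrite (le_trans (norm_blin_comp _ _))// ler_wpM2r.
Qed.

(** The module l^oo(Y), a bounded sequence being encoded as the operator that
    takes the k-th unit vector of l^1 to its k-th term: operator spaces into Y
    are already Banach spaces. *)
Definition linf_module : leftModule A :=
  left_module linf_act_bilinear linf_actA linf_act_bound.

End Left.

Section Right.
Variable Y : rightModule A.

Lemma rm_mul_le a : exists M : R[i], forall y, `|rm_act Y y a| <= M * `|y|.
Proof.
have [c _ cP] := rm_act_bound Y; exists (c * `|a|) => y.
by rewrite mulrAC cP.
Qed.

Lemma rm_mul_subproof a : (fun y => rm_act Y y a) \in @is_blin R Y Y.
Proof.
by have [M] := rm_mul_le a; apply: bounded_is_blin => k x y; exact: linearPl.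
Qed.

Definition rm_mul a : blin Y Y := Blin (rm_mul_subproof a).

Definition l1_ract (y : ell1 Y) a : ell1 Y := ell1_map (rm_mul a) y.

Lemma l1_ract_bilinear : bilinear_for *:%R *:%R l1_ract.
Proof.
split=> [a k x y|y k a b]; apply: ell1_ext => j /=.
  by rewrite linearPl.
by rewrite linearPr.
Qed.

Lemma l1_ractA y a b : l1_ract y (ba_mul A a b) = l1_ract (l1_ract y a) b.
Proof. by apply: ell1_ext => j; exact: rm_actA. Qed.

Lemma l1_ract_bound : exists2 c : R[i], 0 <= c &
  forall y a, `|l1_ract y a| <= c * `|y| * `|a|.
Proof.
have [c c0 cP] := rm_act_bound Y; exists c => // y a.
rewrite (le_trans (norm_ell1_map _ _))// mulrAC ler_wpM2r//.
by apply: opnorm_le => [|x]; [rewrite mulr_ge0|rewrite mulrAC; exact: cP].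
Qed.

Definition l1_rmodule : rightModule A :=
  right_module l1_ract_bilinear l1_ractA l1_ract_bound.

End Right.
End L1Module.

(** * Lifting through split morphisms *)

Section Corestriction.
Variables (R : realType) (X : normedModType R[i]) (V W : banachType R).
Variables (T : blin V W) (f : blin X V).
Hypothesis Tf : forall x, T (f x) = 0.

Lemma ker_corestr_subproof x : f x \in in_ker T.
Proof. by rewrite inE /=; apply/eqP/Tf. Qed.

Lemma ker_corestr_linear : linear (fun x => Ker (ker_corestr_subproof x)).
Proof. by move=> a x y; apply: val_inj; exact: linearP. Qed.

Definition ker_corestr : blin X (ker T) :=
  bounded_blin ker_corestr_linear (le_norm_blin f).

End Corestriction.

Section Linearity.
Variables (R : realType) (V W : normedModType R[i]) (f : blin V W).

Lemma blin0 : f 0 = 0. Proof. exact: linear0. Qed.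
Lemma blinD x y : f (x + y) = f x + f y. Proof. exact: linearD. Qed.
Lemma blinB x y : f (x - y) = f x - f y. Proof. exact: linearB. Qed.

End Linearity.

Section Morphisms.
Variables (R : realType) (A : banachAlgebra R).
Implicit Types X Y Z M : leftModule A.

Lemma hom0 X Y : hom (0 : blin X Y).
Proof. by move=> a x /=; rewrite linear0r. Qed.

Lemma homD X Y (f g : blin X Y) : hom f -> hom g -> hom (f + g).
Proof. by move=> fh gh a x; rewrite !blinDE fh gh linearDr. Qed.

Lemma homB X Y (f g : blin X Y) : hom f -> hom g -> hom (f - g).
Proof. by move=> fh gh a x; rewrite !blinBE fh gh linearBr. Qed.

Lemma homZ X Y (k : R[i]) (f : blin X Y) : hom f -> hom (k *: f).
Proof. by move=> fh a x; rewrite !blinZE fh linearZr. Qed.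

Lemma hom_id X : hom (blin_id X : blin X X).
Proof. by []. Qed.

Lemma hom_comp X Y Z (f : blin Y Z) (g : blin X Y) :
  hom f -> hom g -> hom (blin_comp f g : blin X Z).
Proof. by move=> fh gh a x /=; rewrite gh fh. Qed.

Lemma hom_closed X Y (u : nat -> blin X Y) (f : blin X Y) :
  (forall n, hom (u n)) -> u n @[n --> \oo] --> f -> hom f.
Proof.
move=> uh uf a x.
have ev y : limn (fun n => u n y) = f y.
  apply: cvg_lim; first exact: norm_hausdorff.
  exact: (blin_cvg (f := eval Y y) uf).
have aev : limn (fun n => lm_mul Y a (u n x)) = lm_mul Y a (f x).
  apply: cvg_lim; first exact: norm_hausdorff.
  exact/blin_cvg/(blin_cvg (f := eval Y x) uf).
rewrite -ev -[RHS]aev (_ : (fun n => u n _) = fun n => lm_mul Y a (u n x))//.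
by apply/funext => n; exact: uh.
Qed.

(** The operator d s is an idempotent whose range is that of d. So this range is
    the closed submodule ker (1 - d s), onto which d is an admissible
    epimorphism, and u takes its values there. *)
Lemma projective_lift X Y M (d : blin X Y) (s : blin Y X) (u : blin M Y) :
  hom d -> (forall x, d (s (d x)) = d x) -> projective M -> hom u ->
  (forall m, d (s (u m)) = u m) ->
  exists h : blin M X, hom h /\ forall m, d (h m) = u m.
Proof.
move=> dh dsd Mproj uh dsu.
pose T : blin Y Y := blin_id Y - blin_comp d s.
have TE y : T y = y - d (s y) by [].
have stable a y : T y = 0 -> T (lm_act Y a y) = 0.
  rewrite !TE => /eqP; rewrite subr_eq0 => /eqP->.
  by rewrite -dh dsd subrr.
pose K := ker_module stable.
have Td x : T (d x) = 0 by rewrite TE dsd subrr.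
have Tu m : T (u m) = 0 by rewrite TE dsu subrr.
pose p : blin X K := ker_corestr Td.
pose f : blin M K := ker_corestr Tu.
pose sK : blin K X := blin_comp s (ker_incl T).
have psK y : p (sK y) = y.
  apply: val_inj => /=; have : T (ker_val y) = 0 by apply/eqP/kerP.
  by rewrite TE => /eqP; rewrite subr_eq0 => /eqP.
have pepi : admissible_epi p.
  split; last by exists sK.
    by move=> a x; apply: val_inj; exact: dh.
  by apply/seteqP; split=> // y _; exists (sK y).
have fh : hom f by move=> a x; apply: val_inj; exact: uh.
have [g gh pg] := Mproj _ _ p pepi f fh.
exists g; split=> // m; exact: (congr1 val (pg m)).
Qed.

(** Everything is a cycle in degree 0. For an admissible complex the cycles of
    degree n are exactly the values of the differential from degree n.+1. *)
Definition is_cycle (C : chainComplex A) n : C n -> Prop :=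
  if n is m.+1 return C n -> Prop
  then fun x => cc_diff C m x = 0 else fun=> True.

Lemma admissible_splitting (C : chainComplex A) n : admissible C ->
  exists s : blin (C n) (C n.+1), forall x, is_cycle x -> cc_diff C n (s x) = x.
Proof.
move=> [s [s0 sS]]; exists (s n); case: n => [|n] x; first by rewrite s0.
by move=> /= dx; have := sS n x; rewrite dx linear0 addr0.
Qed.

Lemma is_cycle_diff (C : chainComplex A) n x : is_cycle (cc_diff C n x).
Proof. by case: n x => // n x; exact: cc_diff2. Qed.

(** A total function, with an arbitrary value where no lift exists, so that chain
    maps and homotopies are plain recursions on the degree. *)
Definition lift (C : chainComplex A) M n (u : blin M (C n)) : blin M (C n.+1) :=
  xget 0 [set h : blin M (C n.+1) | hom h /\ forall x, cc_diff C n (h x) = u x].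

Lemma liftP (C : chainComplex A) M n (u : blin M (C n)) :
  admissible C -> projective M -> hom u -> (forall x, is_cycle (u x)) ->
  hom (lift u) /\ forall x, cc_diff C n (lift u x) = u x.
Proof.
move=> /(admissible_splitting n)[s ds] Mproj uh du.
have : exists h : blin M (C n.+1), hom h /\ forall x, cc_diff C n (h x) = u x.
  apply: (projective_lift (s := s) (@cc_hom _ _ C n) _ Mproj uh) => x.
    exact/ds/is_cycle_diff.
  exact: ds.
exact: xgetPex.
Qed.

End Morphisms.

(** * Comparison of resolutions *)

Section Comparison.
Variables (R : realType) (A : banachAlgebra R).
Variables C D : chainComplex A.

Definition chain_map (phi : forall n, blin (C n) (D n)) : Prop :=
  (forall n, hom (phi n)) /\
  forall n x, cc_diff D n (phi n.+1 x) = phi n (cc_diff C n x).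

Hypotheses (Cproj : forall n, projective (C n.+1)) (Dadm : admissible D).

Fixpoint lift_chain (phi0 : blin (C 0) (D 0)) n : blin (C n) (D n) :=
  if n is m.+1 return blin (C n) (D n)
  then lift (blin_comp (lift_chain phi0 m) (cc_diff C m)) else phi0.

Lemma lift_chainP (phi0 : blin (C 0) (D 0)) :
  hom phi0 -> chain_map (lift_chain phi0).
Proof.
move=> h0; have main n : hom (lift_chain phi0 n) /\
    forall x, is_cycle (lift_chain phi0 n (cc_diff C n x)).
  elim: n => [//|n [hn cn]].
  have hd : hom (blin_comp (lift_chain phi0 n) (cc_diff C n)).
    by apply: hom_comp => //; exact: cc_hom.
  have [hS dS] := liftP Dadm (@Cproj _) hd cn.
  by split=> // x /=; rewrite dS /= cc_diff2 blin0.
split=> [n|n x]; first by have [] := main n.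
have [hn cn] := main n.
have hd : hom (blin_comp (lift_chain phi0 n) (cc_diff C n)).
  by apply: hom_comp => //; exact: cc_hom.
by have [_ /= ->] := liftP Dadm (@Cproj _) hd cn.
Qed.

Variable phi : forall n, blin (C n) (D n).

Fixpoint lift_homotopy n : blin (C n) (D n.+1) :=
  if n is m.+1 return blin (C n) (D n.+1)
  then lift (phi m.+1 - blin_comp (lift_homotopy m) (cc_diff C m)) else 0.

Lemma lift_homotopyP : chain_map phi -> phi 0 = 0 ->
  (forall n, hom (lift_homotopy n)) /\
  forall n x, phi n.+1 x = cc_diff D n.+1 (lift_homotopy n.+1 x) +
                           lift_homotopy n (cc_diff C n x).
Proof.
move=> [phih phid] phi0.
pose u n : blin (C n.+1) (D n.+1) :=
  phi n.+1 - blin_comp (lift_homotopy n) (cc_diff C n).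
have uE n x : u n x = phi n.+1 x - lift_homotopy n (cc_diff C n x) by [].
have uh n : hom (lift_homotopy n) -> hom (u n).
  by move=> hn; apply: homB => //; apply: hom_comp => //; exact: cc_hom.
have main n : hom (lift_homotopy n) /\ forall x, is_cycle (u n x).
  elim: n => [|n [hn cn]].
    split=> [|x]; first exact: hom0.
    by rewrite uE /= subr0 phid phi0.
  have [hS dS] := liftP Dadm (@Cproj n) (uh _ hn) cn.
  split=> // x; change (cc_diff D n.+1 (u n.+1 x) = 0).
  rewrite uE blinB phid [X in _ - X]dS -/(u n) uE.
  by rewrite cc_diff2 blin0 subr0 subrr.
split=> [n|n x]; first by have [] := main n.
have [hn cn] := main n.
have [_ dS] := liftP Dadm (@Cproj n) (uh _ hn) cn.
by rewrite -[X in X + _](esym (dS x)) uE subrK.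
Qed.

End Comparison.

Section Independence.
Variables (R : realType) (A : banachAlgebra R).

Lemma homotopic_lifts (C D : chainComplex A)
    (phi psi : forall n, blin (C n) (D n)) :
  (forall n, projective (C n.+1)) -> admissible D ->
  chain_map phi -> chain_map psi -> phi 0 = psi 0 ->
  exists h : forall n, blin (C n) (D n.+1), (forall n, hom (h n)) /\
    forall n x, phi n.+1 x = psi n.+1 x +
      (cc_diff D n.+1 (h n.+1 x) + h n (cc_diff C n x)).
Proof.
move=> Cproj Dadm [phih phid] [psih psid] e0.
pose chi n := phi n - psi n.
have chiE n x : chi n x = phi n x - psi n x by [].
have chiP : chain_map chi.
  split=> [n|n x]; first exact: homB.
  by rewrite !chiE blinB phid psid.
have chi0 : chi 0 = 0 by rewrite /chi e0 subrr.
have [hh hd] := lift_homotopyP Cproj Dadm chiP chi0.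
exists (lift_homotopy chi); split=> // n x.
by rewrite -hd chiE addrC subrK.
Qed.

(** The topology of Ext does not depend on the resolution: chain maps act
    continuously on cochains, and a round trip of chain maps between the two
    resolutions changes a cocycle by a coboundary only. *)
Lemma closure_coboundaries_transfer (X Y : leftModule A)
    (P Q : projResolution X) n :
  @cocycles R A P Y n.+1 `<=` closure (@coboundaries R A P Y n.+1) ->
  @cocycles R A Q Y n.+1 `<=` closure (@coboundaries R A Q Y n.+1).
Proof.
move=> dense g [gh gd].
pose C := augmented (@pr_epsH _ _ _ P) (@pr_epsd _ _ _ P).
pose D := augmented (@pr_epsH _ _ _ Q) (@pr_epsd _ _ _ Q).
have Cproj k : projective (C k.+1) by exact: pr_proj.
have Dproj k : projective (D k.+1) by exact: pr_proj.
have [Cadm Dadm] : admissible C /\ admissible D by split; exact: pr_adm.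
have idX : hom (blin_id X : blin X X) by exact: hom_id.
have phiP := lift_chainP (C := C) (D := D) Cproj Dadm idX.
have psiP := lift_chainP (C := D) (D := C) Dproj Cadm idX.
set phi := lift_chain _ in phiP; set psi := lift_chain _ in psiP.
have [phih phid] := phiP; have [psih psid] := psiP.
have roundP : chain_map (fun k => blin_comp (phi k) (psi k)).
  by split=> [k|k x /=]; [exact: hom_comp|rewrite phid psid].
have idP : chain_map (fun k => blin_id (D k)) by [].
have [|h [hh hd]] := homotopic_lifts Dproj Dadm idP roundP.
  exact: blin_ext.
have gphi : @cocycles R A P Y n.+1 (blin_comp g (phi n.+2)).
  split; first exact: (hom_comp gh (phih n.+2)).
  by move=> x; rewrite -(gd (phi n.+3 x)) -[RHS]/(g (cc_diff D n.+2 _)) phid.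
apply/closureP_norm => e e0.
have N0 : 0 < `|psi n.+2| + 1 by rewrite ltr_wpDl.
have /closureP_norm/(_ _ (divr_gt0 e0 N0))[b [b' b'h bE] bP] := dense _ gphi.
(* The first summand pulls the approximant back to Q; the second accounts for
   the homotopy between the identity and the round trip. *)
pose k : blin (D n.+1) Y := blin_comp b' (psi n.+1) + blin_comp g (h n.+1).
exists (blin_comp k (cc_diff D n.+1)).
  exists k => //; apply: homD; first exact: (hom_comp b'h (psih n.+1)).
  exact: (hom_comp gh (hh n.+1)).
have -> : g - blin_comp k (cc_diff D n.+1) =
          blin_comp (blin_comp g (phi n.+2) - b) (psi n.+2).
  apply: blin_ext => x; pose dx := cc_diff D n.+1 x.
  have gE : g x = g (phi n.+2 (psi n.+2 x)) + g (h n.+1 dx).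
    have gd0 y : g (cc_diff D n.+2 y) = 0 := gd y.
    transitivity (g (phi n.+2 (psi n.+2 x) +
                     (cc_diff D n.+2 (h n.+2 x) + h n.+1 dx))).
      exact: (congr1 g (hd n.+1 x)).
    by rewrite 2!blinD gd0 add0r.
  have bpsi : b (psi n.+2 x) = b' (psi n.+1 dx).
    by rewrite bE; congr (b' _); exact: psid n.+1 x.
  rewrite -[LHS]/(g x - (b' (psi n.+1 dx) + g (h n.+1 dx))).
  rewrite -[RHS]/(g (phi n.+2 (psi n.+2 x)) - b (psi n.+2 x)).
  by rewrite gE bpsi opprD addrACA subrr addr0.
rewrite (le_lt_trans (norm_blin_comp _ _))//.
apply: (@le_lt_trans _ _ (e / (`|psi n.+2| + 1) * `|psi n.+2|)).
  by rewrite ler_wpM2r// ltW.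
by rewrite mulrAC ltr_pdivrMr// ltr_pM2l// ltrDl.
Qed.

End Independence.

(** * Bounded sequences of morphisms *)

Section SequenceModules.
Variables (R : realType) (A : banachAlgebra R).

(** Yinf represents the bounded sequences of morphisms into Y. *)
Definition sequence_module (Y Yinf : leftModule A) (c : nat -> blin Yinf Y) :=
  [/\ forall k, hom (c k) /\ `|c k| <= 1,
      forall y, (forall k, c k y = 0) -> y = 0 &
      forall (M : leftModule A) (f : nat -> blin M Y) (B : R[i]),
        (forall k, hom (f k)) -> (forall k, `|f k| <= B) ->
        exists2 F : blin M Yinf, hom F & forall k x, c k (F x) = f k x].

Definition unit_vector k : ell1 (Cspace R) := single (Cspace R) k (1 : R[i]).

Lemma norm_unit_vector k : `|unit_vector k| <= 1.
Proof.
apply: (le_trans (norm_single _ _)).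
by rewrite -[X in X <= _]/`|1 : R[i]| normr1.
Qed.

Lemma single_scalar k (a : R[i]) :
  single (Cspace R) k a = a *: unit_vector k.
Proof.
rewrite /unit_vector -linearZ; congr (single _ _ _).
by rewrite -[RHS]/(a * 1) mulr1.
Qed.

Definition linf_coord (Y : leftModule A) k : blin (linf_module Y) Y :=
  eval Y (unit_vector k).

Lemma linf_sequence (Y : leftModule A) : sequence_module (@linf_coord Y).
Proof.
have coord0 (y : linf_module Y) : (forall k, linf_coord Y k y = 0) -> y = 0.
  move=> y0; apply: ell1_blin_ext => k a.
  rewrite single_scalar linearZ /= -[X in _ *: X]/(linf_coord Y k y) y0.
  by rewrite scaler0.
split=> // [k|M f B fh fB].
  split=> //; apply: opnorm_le => // y; rewrite mul1r.
  by apply: le_trans (eval_le _ _) (ler_piMl _ (norm_unit_vector k)).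
have gB k : `|blin_comp (line Y) (f k)| <= B.
  apply: le_trans (norm_blin_comp _ _) _; apply: le_trans (fB k).
  by apply: ler_piMl (norm_line _).
pose F : blin M (linf_module Y) := lift_family gB.
have FE k x : linf_coord Y k (F x) = f k x.
  rewrite -[LHS]/(lift_family_fun gB x (unit_vector k)) lift_family_single.
  by rewrite -[LHS]/(1 *: f k x) scale1r.
exists F => // a x; apply/subr0_eq/coord0 => k.
by rewrite blinB FE fh -(FE k x) subrr.
Qed.

Lemma hom_precomp_single (Y : rightModule A) k :
  hom (precomp (Cspace R) (single Y k) : blin (dual (l1_rmodule Y)) (dual Y)).
Proof.
move=> a f; apply: blin_ext => y.
rewrite -[LHS]/(f (ell1_map (rm_mul Y a) (single Y k y))).
by rewrite ell1_map_single.
Qed.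

Lemma dual_sequence (Y : rightModule A) :
  sequence_module (fun k =>
    precomp (Cspace R) (single Y k) : blin (dual (l1_rmodule Y)) (dual Y)).
Proof.
have coord0 (y : dual (l1_rmodule Y)) :
    (forall k, precomp (Cspace R) (single Y k) y = 0) -> y = 0.
  by move=> y0; apply: ell1_blin_ext => k v; exact: (congr1 (eval _ v) (y0 k)).
split=> // [k|M f B fh fB].
  split; first exact: hom_precomp_single.
  apply: opnorm_le => // y; apply: (le_trans (precomp_le _ _)).
  by rewrite ler_wpM2r//; apply: opnorm_le => // v; exact: single_le.
pose F : blin M (dual (l1_rmodule Y)) := lift_family fB.
have FE k x : precomp (Cspace R) (single Y k) (F x) = f k x.
  apply: blin_ext => v.
  by rewrite -[LHS]/(lift_family_fun fB x (single Y k v)) lift_family_single.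
exists F => // a x; apply/subr0_eq/coord0 => k.
by rewrite blinB FE fh -(FE k x) hom_precomp_single subrr.
Qed.

End SequenceModules.

Section L1Resolution.
Variables (R : realType) (A : banachAlgebra R).
Implicit Types X Y M P : leftModule A.

Definition l1_incl Y k : blin Y (l1_module Y) := single Y k.

Lemma hom_l1_incl Y k : hom (l1_incl Y k).
Proof. by move=> a y; exact: esym (ell1_map_single (lm_mul Y a) k y). Qed.

Lemma norm_comp_l1_incl Y X (f : blin (l1_module Y) X) k :
  `|blin_comp f (l1_incl Y k)| <= `|f|.
Proof.
apply: le_trans (norm_blin_comp _ _) (ler_piMr _ _) => //.
by apply: opnorm_le => // v; exact: single_le.
Qed.

Lemma hom_l1 Y X (f : blin (l1_module Y) X) :
  (forall k, hom (blin_comp f (l1_incl Y k) : blin Y X)) -> hom f.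
Proof.
move=> fh a y.
suff: blin_comp f (ell1_map (lm_mul Y a)) = blin_comp (lm_mul X a) f.
  by move/(congr1 (eval _ y)).
apply: ell1_blin_ext => k v.
rewrite -[LHS]/(f (ell1_map (lm_mul Y a) (single Y k v))) ell1_map_single.
exact: fh.
Qed.

Lemma hom_l1_map X Y (f : blin X Y) :
  hom f -> hom (ell1_map f : blin (l1_module X) (l1_module Y)).
Proof. by move=> fh a x; apply: ell1_ext => k; exact: fh. Qed.

(** A morphism out of l^1(P) is a bounded sequence of morphisms out of P, that
    is, a morphism from P to a module of bounded sequences; lifting the latter
    as a whole keeps the lifts of its terms bounded. *)
Lemma projective_l1 P : projective P -> projective (l1_module P).
Proof.
move=> Pproj E F p [ph _ [s ps]] f fh.
have f_hom k : hom (blin_comp f (l1_incl P k) : blin P F).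
  by apply: hom_comp => //; exact: hom_l1_incl.
have [_ coord0 assemble] := linf_sequence F.
have [f' f'h f'E] := assemble P _ _ f_hom (norm_comp_l1_incl f).
pose U := ell1 (Cspace R).
pose p' : blin (linf_module E) (linf_module F) := postcomp U p.
pose s' : blin (linf_module F) (linf_module E) := postcomp U s.
have p's' y : p' (s' y) = y by apply: blin_ext => u; exact: ps.
have p'epi : admissible_epi p'.
  split; last by exists s'.
    by move=> a y; apply: blin_ext => u; exact: ph.
  by apply/seteqP; split=> // y _; exists (s' y).
have [g' g'h g'E] := Pproj _ _ p' p'epi f' f'h.
have g_le k : `|blin_comp (linf_coord E k) g'| <= `|g'|.
  have [/(_ k)[_ c1] _ _] := linf_sequence E.
  exact: le_trans (norm_blin_comp _ _) (ler_piMl _ c1).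
pose g : blin (l1_module P) E := ell1_lift g_le.
have gE k v : g (single P k v) = linf_coord E k (g' v).
  exact: ell1_lift_single.
exists g.
  apply: hom_l1 => k a v; rewrite -[LHS]/(g (single P k _)) gE g'h.
  by rewrite -[RHS]/(lm_act E a (g (single P k v))) gE.
move=> x; suff: blin_comp p g = f by move/(congr1 (eval _ x)).
apply: ell1_blin_ext => k v; rewrite -[LHS]/(p (g (single P k v))) gE.
by rewrite -[LHS]/(linf_coord F k (p' (g' v))) g'E f'E.
Qed.

Section Complex.
Variable C : chainComplex A.

Lemma l1_diff_hom n :
  hom (ell1_map (cc_diff C n) : blin (l1_module (C n.+1)) (l1_module (C n))).
Proof. by apply: hom_l1_map; exact: cc_hom. Qed.

Lemma l1_diff2 n (x : l1_module (C n.+2)) :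
  ell1_map (cc_diff C n) (ell1_map (cc_diff C n.+1) x) = 0.
Proof. by apply: ell1_ext => k; exact: cc_diff2. Qed.

Definition l1_complex : chainComplex A := ChainComplex l1_diff_hom l1_diff2.

End Complex.

Section Resolution.
Variables (Y : leftModule A) (P : projResolution Y).

Definition l1_eps : blin (l1_complex P 0) (l1_module Y) := ell1_map (pr_eps P).

Lemma l1_epsH : hom l1_eps.
Proof. by apply: hom_l1_map; exact: pr_epsH. Qed.

Lemma l1_epsd x : l1_eps (cc_diff (l1_complex P) 0 x) = 0.
Proof. by apply: ell1_ext => k; exact: pr_epsd. Qed.

Lemma l1_adm : admissible (augmented l1_epsH l1_epsd).
Proof.
have [s [s0 sS]] := pr_adm P.
pose t n := match n return
    blin (augmented l1_epsH l1_epsd n) (augmented l1_epsH l1_epsd n.+1) with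
  | 0%N => ell1_map (s 0%N) | m.+1 => ell1_map (s m.+1) end.
exists t; split=> [x|[|n] x]; apply: ell1_ext => k.
- exact: s0.
- exact: (sS 0%N).
- exact: (sS n.+1).
Qed.

Definition l1_resolution : projResolution (l1_module Y) :=
  @ProjResolution R A _ (l1_complex P)
    (fun n => projective_l1 (@pr_proj R A Y P n)) l1_eps l1_epsH l1_epsd l1_adm.

End Resolution.
End L1Resolution.

(** * From dense coboundaries to vanishing *)

Section Vanishing.
Variables (R : realType) (A : banachAlgebra R).

Lemma Ext_trivialP (X Y : leftModule A) n : Ext_topology_trivial n.+1 X Y ->
  forall Q : projResolution X,
    @cocycles R A Q Y n.+1 `<=` closure (@coboundaries R A Q Y n.+1).
Proof. by move=> [P PY] Q; exact: closure_coboundaries_transfer PY. Qed.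

Lemma cocycles_sub_coboundaries (P : chainComplex A) (Y : leftModule A) n :
  (forall z : nat -> blin (P n.+1) Y, (forall k, cocycles (z k)) ->
    (forall k, `|z k| <= 1) ->
    exists (x : nat -> blin (P n) Y) (M : R[i]), forall k,
      [/\ hom (x k), `|x k| <= M &
          `|z k - blin_comp (x k) (cc_diff P n)| <= 2^-1]) ->
  @cocycles R A P Y n.+1 `<=` @coboundaries R A P Y n.+1.
Proof.
move=> approx z Zz.
have [] := @almost_onto R _ _ (precomp Y (cc_diff P n)) (@hom R A (P n) Y)
  (@cocycles R A P Y n.+1) _ _ _ _ _ _ _ approx z Zz.
- exact: hom0.
- by move=> f g; exact: homD.
- by move=> a f; exact: homZ.
- exact: hom_closed.
- move=> f g [fh fd] [gh gd]; split; first exact: homB.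
  by move=> x; rewrite blinBE fd gd subrr.
- move=> a f [fh fd]; split; first exact: homZ.
  by move=> x; rewrite blinZE fd scaler0.
- move=> f fh; split; first by apply: hom_comp => //; exact: cc_hom.
  by move=> x /=; rewrite cc_diff2 blin0.
by move=> g gh gd; exists g => // x; rewrite -gd.
Qed.

Lemma half_approx (P : chainComplex A) (Y : leftModule A) n
    (z : blin (P n.+1) Y) :
  closure (@coboundaries R A P Y n.+1) z ->
  exists2 g : blin (P n) Y, hom g & `|z - blin_comp g (cc_diff P n)| <= 2^-1.
Proof.
have half0 : 0 < (2^-1 : R[i]) by rewrite invr_gt0.
move=> /closureP_norm/(_ _ half0)[b [g gh bE] zb]; exists g => //.
rewrite (_ : blin_comp _ _ = b); first exact: ltW.
by apply: blin_ext => x; rewrite bE.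
Qed.

(** A bounded sequence of cocycles with values in Y is one cocycle with values
    in Yinf, and the terms of a morphism approximating the latter form a bounded
    sequence. *)
Lemma vanishing_of_target (P : chainComplex A) (Y Yinf : leftModule A)
    (c : nat -> blin Yinf Y) n :
  sequence_module c ->
  @cocycles R A P Yinf n.+1 `<=` closure (@coboundaries R A P Yinf n.+1) ->
  @cocycles R A P Y n.+1 `<=` @coboundaries R A P Y n.+1.
Proof.
move=> [ch coord0 assemble] dense.
apply: cocycles_sub_coboundaries => z Zz z1.
have [F Fh FE] := assemble _ z 1 (fun k => (Zz k).1) z1.
have FZ : cocycles F.
  split=> // x; apply: coord0 => k; rewrite FE; exact: (Zz k).2.
have [g gh Fg] := half_approx (dense F FZ).
have c_le M (f : blin M Yinf) k : `|blin_comp (c k) f| <= `|f|.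
  exact: le_trans (norm_blin_comp _ _) (ler_piMl _ (ch k).2).
exists (fun k => blin_comp (c k) g), `|g| => k; split=> //.
  by apply: hom_comp => //; have [] := ch k.
suff -> : z k - blin_comp (blin_comp (c k) g) (cc_diff P n) =
          blin_comp (c k) (F - blin_comp g (cc_diff P n)).
  exact: le_trans (c_le _ _ k) Fg.
apply: blin_ext => x; rewrite -[RHS]/(c k (F x - g (cc_diff P n x))).
by rewrite blinB FE.
Qed.

(** The same argument with the sequence of cocycles seen as one cocycle on the
    complex l^1(P). *)
Lemma vanishing_of_source (P : chainComplex A) (X : leftModule A) n :
  @cocycles R A (l1_complex P) X n.+1 `<=`
    closure (@coboundaries R A (l1_complex P) X n.+1) ->
  @cocycles R A P X n.+1 `<=` @coboundaries R A P X n.+1.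
Proof.
move=> dense; apply: cocycles_sub_coboundaries => z Zz z1.
pose F : blin (l1_complex P n.+1) X := ell1_lift z1.
have FE k v : F (single _ k v) = z k v by exact: ell1_lift_single.
have FZ : cocycles F.
  split.
    apply: hom_l1 => k a v; rewrite -[LHS]/(F (single _ k _)) FE.
    by rewrite -[RHS]/(lm_act X a (F (single _ k v))) FE (Zz k).1.
  move=> x; suff: blin_comp F (ell1_map (cc_diff P n.+1)) = 0.
    by move/(congr1 (eval _ x)).
  apply: ell1_blin_ext => k v.
  rewrite -[LHS]/(F (ell1_map (cc_diff P n.+1) (single _ k v))).
  by rewrite ell1_map_single FE (Zz k).2.
have [g gh Fg] := half_approx (dense F FZ).
exists (fun k => blin_comp g (l1_incl (P n) k)), `|g| => k; split.
- by apply: hom_comp => //; exact: hom_l1_incl.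
- exact: norm_comp_l1_incl.
have le_k := norm_comp_l1_incl
  (F - blin_comp g (cc_diff (l1_complex P) n) : blin (l1_module (P n.+1)) X) k.
suff -> : z k - blin_comp (blin_comp g (l1_incl (P n) k)) (cc_diff P n) =
          blin_comp (F - blin_comp g (cc_diff (l1_complex P) n))
                    (l1_incl (P n.+1) k).
  exact: le_trans le_k Fg.
apply: blin_ext => v.
rewrite -[RHS]/(F (single _ k v) -
  g (ell1_map (cc_diff P n) (single _ k v))).
by rewrite FE ell1_map_single.
Qed.

Lemma least_le (Q : nat -> Prop) n : Q n -> (least R Q <= n%:R%:E)%E.
Proof. by move=> Qn; apply: ereal_inf_lbound; exists n. Qed.

End Vanishing.

Theorem proposition4p1 (R : realType) (A : banachAlgebra R) (X : leftModule A)
    (n : nat) :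
  ((forall Y : leftModule A, Ext_topology_trivial n.+1 X Y) ->
    (dh X <= n%:R%:E)%E) /\
  ((forall Y : leftModule A, Ext_topology_trivial n.+1 Y X) ->
    (inj_dh X <= n%:R%:E)%E) /\
  ((forall Y : rightModule A, Ext_topology_trivial n.+1 X (dual Y)) ->
    (w_dh X <= n%:R%:E)%E).
Proof.
split=> [triv|]; last split=> [triv|triv]; apply: least_le => Y P.
- exact: vanishing_of_target (linf_sequence Y) (Ext_trivialP (triv _) (Q := P)).
- exact: vanishing_of_source (Ext_trivialP (triv _) (Q := l1_resolution P)).
- exact: vanishing_of_target (dual_sequence Y) (Ext_trivialP (triv _) (Q := P)).
Qed.
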